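(* Let $(G,\Lambda)$ be a self-similar $k$-graph satisfying (FV) and (Cyc). Suppose that $k<\infty$ and that $\Lambda$ has only one maximal tail. Then the bijection $$\Phi:\coprod_{T\text{ a maximal tail of }\Lambda}\{T\}\times\widehat{\mathrm{Per}}_{H_T\Lambda T}\to\mathrm{Prim}(\mathcal{O}_{G,\Lambda}),\qquad \Phi(T,f)=\ker(\pi_{\widetilde f,x}),$$ is a homeomorphism, where $\mathrm{Prim}(\mathcal{O}_{G,\Lambda})$ carries the Jacobson (hull-kernel) topology, $\widetilde f$ is any character of $\mathbb{Z}^k$ extending $f$, and $x$ is any cofinal infinite path in $\Lambda T$.
   Context: Conventions. $k$ is a positive integer; $\mathbb{N}=\{0,1,2,\dots\}$. $\widehat{A}$ is the (compact) group of characters of a discrete abelian group $A$. $k$-graphs. A $k$-graph is a countable small category $\Lambda$ with a functor $d:\Lambda\to\mathbb{N}^k$ such that whenever $d(\mu)=p+q$ there are unique $\alpha,\beta$ with $\mu=\alpha\beta$, $d(\alpha)=p$, $d(\beta)=q$. Write $r,s$ for range and source, $\Lambda^p=d^{-1}(p)$ ($\Lambda^0$ is the vertex set), $AB=\{\mu\nu:\mu\in A,\nu\in B,s(\mu)=r(\nu)\}$. All $k$-graphs are row-finite ($|v\Lambda^p|<\infty$) and source-free ($v\Lambda^p\neq\varnothing$). An infinite path is a degree-preserving functor $x$ from the category $\{(p,q)\in\mathbb{N}^k\times\mathbb{N}^k:p\le q\}$ (with $r(p,q)=(p,p)$, $s(p,q)=(q,q)$, $d(p,q)=q-p$) to $\Lambda$;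 $\Lambda^\infty$ is the set of infinite paths, $\sigma^p(x)(m,n)=x(p+m,p+n)$, and $v\Lambda^\infty=\{x:x(0,0)=v\}$. Self-similar $k$-graph. A countable discrete group $G$ acting on $\Lambda$ with a map $(g,\mu)\mapsto g|_\mu\in G$ such that: $g\cdot\Lambda^p\subseteq\Lambda^p$; $s(g\cdot\mu)=g\cdot s(\mu)$, $r(g\cdot\mu)=g\cdot r(\mu)$; $g\cdot(\mu\nu)=(g\cdot\mu)(g|_\mu\cdot\nu)$ and $g|_{\mu\nu}=(g|_\mu)|_\nu$ when $s(\mu)=r(\nu)$; $g|_v=g$ for $v\in\Lambda^0$; $1_G|_\mu=1_G$; $(gh)|_\mu=g|_{h\cdot\mu}\,h|_\mu$. All are assumed pseudo free: $g\cdot\mu=\mu$, $g|_\mu=1_G$ imply $g=1_G$. $G$ acts on $\Lambda^\infty$ by $(g\cdot x)(p,q)=g|_{x(0,p)}\cdot x(p,q)$. The C*-algebra. A self-similar $(G,\Lambda)$-family $\{U,S\}$ in a unital C*-algebra consists of unitaries $U_g$ and partial isometries $S_\mu$ with: $\{S_v\}_{v\in\Lambda^0}$ mutually orthogonal projections; $S_{\mu\nu}=S_\mu S_\nu$ if $s(\mu)=r(\nu)$; $S_\mu^*S_\mu=S_{s(\mu)}$; $S_v=\sum_{\mu\in v\Lambda^p}S_\mu S_\mu^*$; $U_{gh}=U_gU_h$; $U_gS_\mu=S_{g\cdot\mu}U_{g|_\mu}$. With $\{u,s\}$ the universal such family, $\mathcal{O}_{G,\Lambda}=\overline{\mathrm{span}}\{s_\mu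 u_gs_\nu^*:g\in G,\ s(\mu)=g\cdot s(\nu)\}$. Cycline triples and periodicity. $(\mu,g,\nu)$ with $s(\mu)=g\cdot s(\nu)$ is a cycline triple of $(G,\Lambda)$ if $\mu(g\cdot x)=\nu x$ for all $x\in s(\nu)\Lambda^\infty$; it is a cycline pair, also written $(\mu,\nu)$, if $g=1_G$ (then it depends only on $\Lambda$). $\mathrm{Per}_{G,\Lambda}=\{d(\mu)-d(\nu):(\mu,g,\nu)\text{ a cycline triple}\}$ and $\mathrm{Per}_\Lambda=\{d(\mu)-d(\nu):(\mu,\nu)\text{ a cycline pair}\}$. Maximal tails. A nonempty $T\subseteq\Lambda^0$ is a maximal tail if: (i) $v\in T$, $w\in\Lambda^0$, $w\Lambda v\ne\varnothing$ imply $w\in T$; (ii) $v\Lambda^pT\ne\varnothing$ for all $v\in T$, $p\in\mathbb{N}^k$; (iii) for $v_1,v_2\in T$ there is $w\in T$ with $v_1\Lambda w$, $v_2\Lambda w$ nonempty. Then $\Lambda T=\{\mu:s(\mu)\in T\}$ is a $k$-graph with vertex set $T$. $H_T$ is the set of $v\in T$ such that for all $p,q\in\mathbb{N}^k$ with $p-q\in\mathrm{Per}_{G,\Lambda T}$ and all $\mu\in v\Lambda^pT$ there is a unique $\nu\in v\Lambda^qT$ such that $(\mu,\nu)$ is a cycline pair of $\Lambda T$. $H_T$ is a nonempty hereditary set, $H_T\Lambda T$ is a $k$-graph, and $\mathrm{Per}_{H_T\Lambda T}$ is a subgroup of $\mathbb{Z}^k$. An infinite path $x$ in $\Lambda T$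 is cofinal if for every $v\in T$ there is $p$ with $v\Lambda x(p,p)\neq\varnothing$ (such $x$ exist). Conditions. (FV): $g\cdot v=v$ for all $g\in G$, $v\in\Lambda^0$. (Cyc): for every maximal tail $T$ of $\Lambda$, every cycline triple of the self-similar $k$-graph $(G,\Lambda T)$ is a cycline pair. Representations. For $x\in\Lambda^\infty$ let $[x]=\{y\in\Lambda^\infty:\sigma^p(x)=g\cdot\sigma^q(y)\text{ for some }p,q\in\mathbb{N}^k,g\in G\}$. For $F\in\widehat{\mathbb{Z}^k}$, $\pi_{F,x}$ is the representation of $\mathcal{O}_{G,\Lambda}$ on $\ell^2([x])$ with $\pi_{F,x}(s_\mu u_gs_\nu^* )=S_\mu U_gS_\nu^*$, where $U_g\delta_y=\delta_{g\cdot y}$, and $S_\mu\delta_y=F(d(\mu))\delta_{\mu y}$ if $s(\mu)=y(0,0)$, $S_\mu\delta_y=0$ otherwise. The map $\Phi$ of the claim is well defined (independent of $\widetilde f$ and $x$) and bijective. *)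

(* Defs.v *)
From HB Require Import structures.
From mathcomp Require Import all_boot all_order all_algebra.
From mathcomp Require Import sesquilinear complex.
From mathcomp Require Import all_classical all_reals all_analysis.

Set Implicit Arguments.
Unset Strict Implicit.
Unset Printing Implicit Defensive.

Import Order.TTheory GRing.Theory Num.Theory.
Import numFieldNormedType.Exports.

Local Open Scope classical_set_scope.
Local Open Scope ring_scope.

Notation degree k := {ffun 'I_k -> nat}.
Notation lattice k := {ffun 'I_k -> int}.

Definition dle k (p q : degree k) : bool := [forall i, (p i <= q i)%N].

Definition degZ k (p : degree k) : lattice k := [ffun i => (p i)%:Z].

Lemma dle0d k (p : degree k) : dle 0 p.
Proof. by apply/forallP => i; rewrite ffunE. Qed.

Lemma dle_add2l k (m p q : degree k) : dle p q -> dle (m + p) (m + q).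
Proof.
by move=> /forallP pq; apply/forallP => i; rewrite !ffunE leq_add2l.
Qed.

(* The category is given by its morphisms alone: an object is identified with
   its identity, so that [rg] and [sc] take values in the morphisms, [kcomp m n]
   is meaningful only when [sc m = rg n], and (by [kg_fact] and [kg_deg]) the
   identities are exactly the morphisms of degree 0.  Row-finiteness and the
   absence of sources are part of the structure. *)
Record kGraph (k : nat) := KGraph {
  kg_car :> countType;
  deg : kg_car -> degree k;
  rg : kg_car -> kg_car;
  sc : kg_car -> kg_car;
  kcomp : kg_car -> kg_car -> kg_car;
  kg_sc_rg : forall m, sc (rg m) = rg m;
  kg_rg_sc : forall m, rg (sc m) = sc m;
  kg_rg_comp : forall m n, sc m = rg n -> rg (kcomp m n) = rg m;
  kg_sc_comp : forall m n, sc m = rg n -> sc (kcomp m n) = sc n;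
  kg_comp_id : forall m, kcomp (rg m) m = m;
  kg_id_comp : forall m, kcomp m (sc m) = m;
  kg_compA : forall l m n, sc l = rg m -> sc m = rg n ->
    kcomp l (kcomp m n) = kcomp (kcomp l m) n;
  kg_deg : forall m n, sc m = rg n -> deg (kcomp m n) = deg m + deg n;
  kg_fact : forall m p q, deg m = p + q ->
    exists! ab : kg_car * kg_car,
      [/\ sc ab.1 = rg ab.2, deg ab.1 = p, deg ab.2 = q & m = kcomp ab.1 ab.2];
  kg_row_finite : forall v p, deg v = 0 ->
    finite_set [set m | rg m = v /\ deg m = p];
  kg_source_free : forall v p, deg v = 0 ->
    [set m | rg m = v /\ deg m = p] !=set0
}.

Definition vertices k (L : kGraph k) : set L := [set v | deg v = 0].

(* v Lambda^p *)
Definition paths_from k (L : kGraph k) (v : L) (p : degree k) : set L :=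
  [set m | rg m = v /\ deg m = p].

Definition reaches k (L : kGraph k) (v w : L) : Prop :=
  exists m : L, rg m = v /\ sc m = w.

Record selfSimilar (G : groupType) k (L : kGraph k) := SelfSimilar {
  act : G -> L -> L;
  res : G -> L -> G;
  act_1 : forall m, act 1%g m = m;
  act_M : forall g h m, act (g * h)%g m = act g (act h m);
  act_deg : forall g m, deg (act g m) = deg m;
  act_sc : forall g m, sc (act g m) = act g (sc m);
  act_rg : forall g m, rg (act g m) = act g (rg m);
  act_comp : forall g m n, sc m = rg n ->
    act g (kcomp m n) = kcomp (act g m) (act (res g m) n);
  res_comp : forall g m n, sc m = rg n -> res g (kcomp m n) = res (res g m) n;
  res_vertex : forall g v, deg v = 0 -> res g v = g;
  res_1 : forall m, res 1%g m = 1%g;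
  res_M : forall g h m, res (g * h)%g m = (res g (act h m) * res h m)%g;
  pseudo_free : forall g m, act g m = m -> res g m = 1%g -> g = 1%g
}.

Definition omega k := {pq : degree k * degree k | dle pq.1 pq.2}.

Definition seg k (p q : degree k) (h : dle p q) : omega k :=
  exist (fun pq : degree k * degree k => dle pq.1 pq.2) (p, q) h.

Notation raw_path L := (omega _ -> kg_car L).

(* Infinite paths of the subcategory of [L] with set of morphisms [D].  The
   k-graphs [Lambda T] and [H Lambda T] are handled throughout as such sets of
   morphisms of the ambient k-graph. *)
Definition infinite_path k (L : kGraph k) (D : set L) : set (raw_path L) :=
  [set x | [/\ forall pq, D (x pq),
      forall p q (h : dle p q), p + deg (x (seg h)) = q,
      forall p q (h : dle p q) (hp : dle p p), rg (x (seg h)) = x (seg hp),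
      forall p q (h : dle p q) (hq : dle q q), sc (x (seg h)) = x (seg hq) &
      forall p q t (h : dle p q) (h' : dle q t) (h'' : dle p t),
        x (seg h'') = kcomp (x (seg h)) (x (seg h'))]].

Definition initial k (L : kGraph k) (x : raw_path L) (p : degree k) : L :=
  x (seg (dle0d p)).

Definition origin k (L : kGraph k) (x : raw_path L) : L := initial x 0.

Definition path_shift k (L : kGraph k) (p : degree k) (x : raw_path L) :
  raw_path L := fun mn => x (seg (dle_add2l p (valP mn))).

Definition path_act (G : groupType) k (L : kGraph k) (S : selfSimilar G L)
    (g : G) (x : raw_path L) : raw_path L :=
  fun pq => act S (res S g (initial x (val pq).1)) (x pq).

(* y = m x *)
Definition is_concat k (L : kGraph k) (m : L) (x y : raw_path L) : Prop :=
  initial y (deg m) = m /\ path_shift (deg m) y = x.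

Definition orbit_class (G : groupType) k (L : kGraph k) (S : selfSimilar G L)
    (x : raw_path L) : set (raw_path L) :=
  [set y | infinite_path setT y /\
    exists p q g, path_shift p x = path_act S g (path_shift q y)].

Definition cycline (G : groupType) k (L : kGraph k) (S : selfSimilar G L)
    (D : set L) (m : L) (g : G) (n : L) : Prop :=
  [/\ D m, D n, sc m = act S g (sc n) &
    forall x, infinite_path D x -> origin x = sc n ->
      exists y, [/\ infinite_path D y, is_concat m (path_act S g x) y &
                    is_concat n x y]].

Definition cycline_pair (G : groupType) k (L : kGraph k) (S : selfSimilar G L)
    (D : set L) (m n : L) : Prop := cycline S D m 1%g n.

(* Per_{G, D} *)
Definition PerG (G : groupType) k (L : kGraph k) (S : selfSimilar G L)
    (D : set L) : set (lattice k) :=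
  [set z | exists m g n, cycline S D m g n /\ z = degZ (deg m) - degZ (deg n)].

(* Per_D *)
Definition Per (G : groupType) k (L : kGraph k) (S : selfSimilar G L)
    (D : set L) : set (lattice k) :=
  [set z | exists m n, cycline_pair S D m n /\ z = degZ (deg m) - degZ (deg n)].

Definition maximal_tail k (L : kGraph k) : set (set L) :=
  [set T | [/\ T !=set0, T `<=` @vertices k L,
    forall v w, T v -> vertices w -> reaches w v -> T w,
    forall v p, T v -> exists m, paths_from v p m /\ T (sc m) &
    forall v1 v2, T v1 -> T v2 ->
      exists w, [/\ T w, reaches v1 w & reaches v2 w]]].

(* Lambda T *)
Definition tail_graph k (L : kGraph k) (T : set L) : set L := [set m | T (sc m)].

Definition Hset (G : groupType) k (L : kGraph k) (S : selfSimilar G L)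
    (T : set L) : set L :=
  [set v | T v /\ forall p q : degree k,
    PerG S (tail_graph T) (degZ p - degZ q) ->
    forall m, paths_from v p m -> T (sc m) ->
    exists! n, [/\ paths_from v q n, T (sc n) &
                   cycline_pair S (tail_graph T) m n]].

(* H_T Lambda T *)
Definition Hgraph (G : groupType) k (L : kGraph k) (S : selfSimilar G L)
    (T : set L) : set L := [set m | Hset S T (rg m) /\ T (sc m)].

Definition cofinal_path k (L : kGraph k) (T : set L) (x : raw_path L) : Prop :=
  infinite_path (tail_graph T) x /\
  forall v, T v -> exists p (h : dle p p), reaches v (x (seg h)).

Definition condFV (G : groupType) k (L : kGraph k) (S : selfSimilar G L) : Prop :=
  forall g (v : L), vertices v -> act S g v = v.

Definition condCyc (G : groupType) k (L : kGraph k) (S : selfSimilar G L) : Prop :=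
  forall T, maximal_tail T ->
  forall m g n, cycline S (tail_graph T) m g n -> g = 1%g.

(* The dual of a subgroup [P] of Z^k, with the topology of pointwise
   convergence, which is the compact-open topology since [P] is discrete. *)
Definition is_character (R : realType) k (P : set (lattice k)) :
    set {ptws set_type P -> R[i]^o} :=
  [set f | (forall a, `|f a| = 1) /\
    forall a b c : set_type P, val c = val a + val b -> f c = f a * f b].

Definition dual (R : realType) k (P : set (lattice k)) : topologicalType :=
  set_type (@is_character R k P).

Definition dual_app (R : realType) k (P : set (lattice k)) (f : dual R P)
    (z : set_type P) : R[i] := set_val f z.

Definition dual_appT (R : realType) k (F : dual R [set: lattice k])
    (z : lattice k) : R[i] := dual_app F (exist _ z (in_setT z)).

Definition extends (R : realType) k (P : set (lattice k))
    (F : dual R [set: lattice k]) (f : dual R P) : Prop :=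
  forall z : set_type P, dual_appT F (val z) = dual_app f z.

(* Unital C*-algebras.  The library's algebra and normed module structures have
   no common refinement short of the numeric domains, so the product [**] and
   the unit are part of this structure. *)
HB.mixin Record isCStarAlgebra (R : realType) A
    & CompleteNormedModule R[i] A := {
  cmul : A -> A -> A;
  cone : A;
  star : A -> A;
  cmulA : associative cmul;
  cmul1l : left_id cone cmul;
  cmul1r : right_id cone cmul;
  cmulDl : left_distributive cmul +%R;
  cmulDr : right_distributive cmul +%R;
  cmulZl : forall (c : R[i]) (a b : A), cmul (c *: a) b = c *: cmul a b;
  cmulZr : forall (c : R[i]) (a b : A), cmul a (c *: b) = c *: cmul a b;
  starD : forall a b : A, star (a + b) = star a + star b;
  starZ : forall (c : R[i]) (a : A), star (c *: a) = Num.conj c *: star a;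
  starM : forall a b : A, star (cmul a b) = cmul (star b) (star a);
  starK : involutive star;
  cstar_normM : forall a b : A, `|cmul a b| <= `|a| * `|b|;
  cstar_identity : forall a : A, `|cmul (star a) a| = `|a| ^+ 2
}.

#[short(type="cstarAlgType")]
HB.structure Definition CStarAlgebra (R : realType) :=
  { A of isCStarAlgebra R A & CompleteNormedModule R[i] A }.

Reserved Notation "a ** b" (at level 40, left associativity).
Notation "a ** b" := (cmul a b) : ring_scope.

Definition star_morphism (R : realType) (A B : cstarAlgType R)
    (phi : {linear A -> B}) : Prop :=
  [/\ phi cone = cone, forall a b, phi (a ** b) = phi a ** phi b &
      forall a, phi (star a) = star (phi a)].

HB.mixin Record isHilbert (R : realType) H & CompleteNormedModule R[i] H := {
  inner : {dot H for Num.conj};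
  inner_norm : forall xi : H, inner xi xi = `|xi| ^+ 2
}.

#[short(type="hilbertType")]
HB.structure Definition Hilbert (R : realType) :=
  { H of isHilbert R H & CompleteNormedModule R[i] H }.

Definition lspan (R : realType) (V : lmodType R[i]) (X : set V) : set V :=
  [set a | exists n (c : 'I_n -> R[i]) (e : 'I_n -> V),
    (forall i, X (e i)) /\ a = \sum_(i < n) c i *: e i].

(* Norm-closed *-subalgebras, not necessarily containing the unit. *)
Record subCstar (R : realType) (A : cstarAlgType R) := SubCstar {
  sub_set :> A -> Prop;
  sub_closed : closed (sub_set : set A);
  sub_0 : sub_set 0;
  sub_D : forall a b, sub_set a -> sub_set b -> sub_set (a + b);
  sub_Z : forall (c : R[i]) a, sub_set a -> sub_set (c *: a);
  sub_M : forall a b, sub_set a -> sub_set b -> sub_set (a ** b);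
  sub_star : forall a, sub_set a -> sub_set (star a)
}.

(* [pi] matters on [O] only. *)
Record representation (R : realType) (A : cstarAlgType R) (O : subCstar A)
    (H : hilbertType R) (pi : A -> {linear H -> H}) : Prop := Representation {
  rep_continuous : forall a, O a -> continuous (pi a);
  rep_D : forall a b xi, O a -> O b -> pi (a + b) xi = pi a xi + pi b xi;
  rep_Z : forall (c : R[i]) a xi, O a -> pi (c *: a) xi = c *: pi a xi;
  rep_M : forall a b xi, O a -> O b -> pi (a ** b) xi = pi a (pi b xi);
  rep_star : forall a xi eta, O a ->
    inner (pi a xi) eta = inner xi (pi (star a) eta)
}.

Definition rep_ker (R : realType) (A : cstarAlgType R) (O : subCstar A)
    (H : hilbertType R) (pi : A -> {linear H -> H}) : set A :=
  [set a | O a /\ forall xi, pi a xi = 0].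

Definition irreducible_rep (R : realType) (A : cstarAlgType R) (O : subCstar A)
    (H : hilbertType R) (pi : A -> {linear H -> H}) : Prop :=
  (exists a xi, O a /\ pi a xi <> 0) /\
  forall M : set H, closed M -> M 0 ->
    (forall xi eta, M xi -> M eta -> M (xi + eta)) ->
    (forall (c : R[i]) xi, M xi -> M (c *: xi)) ->
    (forall a xi, O a -> M xi -> M (pi a xi)) ->
    M = [set 0] \/ M = setT.

Definition primitive_ideal (R : realType) (A : cstarAlgType R)
    (O : subCstar A) : set (set A) :=
  [set I | exists (H : hilbertType R) (pi : A -> {linear H -> H}),
    [/\ representation O pi, irreducible_rep O pi & I = rep_ker O pi]].

Definition Prim (R : realType) (A : cstarAlgType R) (O : subCstar A) : Type :=
  set_type (primitive_ideal O).

HB.instance Definition _ (R : realType) (A : cstarAlgType R)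
  (O : subCstar A) := Choice.copy (Prim O) (set_type (primitive_ideal O)).

Section HullKernel.
Context (R : realType) (A : cstarAlgType R) (O : subCstar A).

Definition ideal_of (P : Prim O) : set A := set_val P.

Definition hk_kernel (X : set (Prim O)) : set A :=
  [set a | O a /\ forall P, X P -> ideal_of P a].

Definition hk_hull (I : set A) : set (Prim O) := [set P | I `<=` ideal_of P].

Definition hk_closed (X : set (Prim O)) : Prop := hk_hull (hk_kernel X) = X.

Let hk_open (U : set (Prim O)) : Prop := hk_closed (~` U).

Let hk_closedP (X : set (Prim O)) :
  hk_closed X <-> (forall P, hk_kernel X `<=` ideal_of P -> X P).
Proof.
split=> [XX P|XX]; first by rewrite -[in X in _ -> X]XX.
by apply/seteqP; split=> // P XP a [_]; exact.
Qed.

Let ideal_ofP (P : Prim O) : primitive_ideal O (ideal_of P).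
Proof. exact/set_mem/(valP P). Qed.

Let hk_kernelM (X : set (Prim O)) a b : hk_kernel X a -> O b ->
  hk_kernel X (a ** b) /\ hk_kernel X (b ** a).
Proof.
move=> [Oa Xa] Ob; split; (split; first exact: sub_M) => P XP;
  have [H [pi [rpi _ eP]]] := ideal_ofP P; have := Xa P XP; rewrite eP => -[_ a0];
  (split; first exact: sub_M) => xi; rewrite (rep_M rpi)// a0//.
exact: linear0.
Qed.

Let hk_openT : hk_open setT.
Proof.
apply/hk_closedP => P; have [H [pi [rpi [[a [xi [Oa n0]]] _] eP]]] := ideal_ofP P.
move=> /(_ a); rewrite eP => h; exfalso; apply: n0.
by have [|_ ->] := h _; first by split=> // Q; rewrite setCT.
Qed.

Let hk_openI : setI_closed hk_open.
Proof.
move=> U V /hk_closedP cU /hk_closedP cV; apply/hk_closedP => P kP.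
rewrite setCI; apply: contrapT => /not_orP[PU PV].
have /existsNP[i /not_implyP[ki nPi]] : ~ (hk_kernel (~` U) `<=` ideal_of P).
  by move/cU.
have /existsNP[j /not_implyP[kj nPj]] : ~ (hk_kernel (~` V) `<=` ideal_of P).
  by move/cV.
have [H [pi [rpi [_ irr] eP]]] := ideal_ofP P.
pose K : set H := [set xi | forall a, hk_kernel (~` U) a -> pi a xi = 0].
have [] := irr K.
- have -> : K = \bigcap_(a in hk_kernel (~` U)) (pi a @^-1` [set 0]) by [].
  apply: closed_bigI => a [Oa _]; apply: closed_comp.
    by move=> xi _; exact: (rep_continuous rpi Oa).
  exact: accessible_closed_set1 (hausdorff_accessible (@norm_hausdorff _ _)) _.
- by move=> a _; exact: linear0.
- by move=> xi eta Kxi Keta a ka; rewrite linearD Kxi// Keta// addr0.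
- by move=> c xi Kxi a ka; rewrite linearZ /= Kxi// scaler0.
- move=> b xi Ob Kxi a ka; rewrite -(rep_M rpi)//; last by case: ka.
  by apply: Kxi; case: (hk_kernelM ka Ob).
- move=> K0; apply: nPj; rewrite eP; split; first by case: kj.
  move=> xi; suff : K (pi j xi) by rewrite K0.
  move=> a ka; rewrite -(rep_M rpi); [|by case: ka|by case: kj].
  suff /kP : hk_kernel (~` (U `&` V)) (a ** j) by rewrite eP => -[].
  have [[Oaj Uaj] _] := hk_kernelM ka (proj1 kj).
  have [_ [_ Vaj]] := hk_kernelM kj (proj1 ka).
  by split=> [//|Q]; rewrite setCI => -[/Uaj|/Vaj].
- move=> KT; apply: nPi; rewrite eP; split; first by case: ki.
  by move=> xi; have : K xi by [rewrite KT]; apply.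
Qed.

Let hk_open_bigU (I : Type) (f : I -> set (Prim O)) :
  (forall i, hk_open (f i)) -> hk_open (\bigcup_i f i).
Proof.
move=> cf; apply/hk_closedP => P kP [i _ fiP].
have /hk_closedP /(_ P) := cf i; apply=> // a [Oa ka]; apply: kP.
by split=> // Q nQ; apply: ka => fiQ; apply: nQ; exists i.
Qed.

HB.instance Definition _ := isOpenTopological.Build (Prim O)
  hk_openT hk_openI hk_open_bigU.

Lemma closed_Prim (X : set (Prim O)) : closed X <-> hk_closed X.
Proof.
have openE' (U : set (Prim O)) : open U = hk_open U by [].
by rewrite -openC openE' /hk_open setCK.
Qed.

End HullKernel.

Record family (R : realType) (G : groupType) k (L : kGraph k)
    (S : selfSimilar G L) (B : cstarAlgType R) (U : G -> B) (s : L -> B)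
    : Prop := Family {
  fam_unitary : forall g, star (U g) ** U g = cone /\ U g ** star (U g) = cone;
  fam_partial_isometry : forall m, s m ** star (s m) ** s m = s m;
  fam_projection : forall v, vertices v -> star (s v) = s v /\ s v ** s v = s v;
  fam_orthogonal : forall v w, vertices v -> vertices w -> v <> w ->
    s v ** s w = 0;
  fam_comp : forall m n, sc m = rg n -> s (kcomp m n) = s m ** s n;
  fam_source : forall m, star (s m) ** s m = s (sc m);
  fam_range : forall v p, vertices v ->
    s v = \sum_(m \in paths_from v p) (s m ** star (s m));
  fam_unitaryM : forall g h, U (g * h)%g = U g ** U h;
  fam_cov : forall g m, U g ** s m = s (act S g m) ** U (res S g m)
}.

Definition universal_family (R : realType) (G : groupType) k (L : kGraph k)
    (S : selfSimilar G L) (A : cstarAlgType R) (u : G -> A) (s : L -> A) : Prop :=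
  family S u s /\
  forall (B : cstarAlgType R) (U : G -> B) (t : L -> B), family S U t ->
    exists phi : {linear A -> B},
      let compatible (psi : {linear A -> B}) :=
        [/\ star_morphism psi, forall g, psi (u g) = U g &
            forall m, psi (s m) = t m] in
      compatible phi /\ forall psi, compatible psi -> psi =1 phi.

(* The closed linear span of the s_m u_g s_n^* with s(m) = g . s(n) *)
Definition OGL (R : realType) (G : groupType) k (L : kGraph k)
    (S : selfSimilar G L) (A : cstarAlgType R) (u : G -> A) (s : L -> A) : set A :=
  closure (lspan [set a | exists m g n,
    sc m = act S g (sc n) /\ a = s m ** u g ** star (s n)]).

(* [H] is l^2(X), with [delta] as its canonical orthonormal basis: an
   orthonormal family indexed by [X] with dense linear span. *)
Definition is_l2 (R : realType) (I : Type) (X : set I) (H : hilbertType R)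
    (delta : I -> H) : Prop :=
  [/\ forall y, X y -> inner (delta y) (delta y) = 1,
      forall y z, X y -> X z -> y <> z -> inner (delta y) (delta z) = 0 &
      closure (lspan (delta @` X)) = setT].

(* [V] and [Vs] are the bounded operators S_m and S_m^*; [W] is U_g. *)
Definition is_pi (R : realType) (G : groupType) k (L : kGraph k)
    (S : selfSimilar G L) (A : cstarAlgType R) (u : G -> A) (s : L -> A)
    (O : subCstar A) (F : dual R [set: lattice k]) (x : raw_path L)
    (H : hilbertType R) (delta : raw_path L -> H)
    (pi : A -> {linear H -> H}) : Prop :=
  [/\ is_l2 (orbit_class S x) delta, representation O pi &
    exists (V Vs : L -> {linear H -> H}) (W : G -> {linear H -> H}),
    [/\ forall m, [/\ continuous (V m), continuous (Vs m) &
          forall xi eta, inner (V m xi) eta = inner xi (Vs m eta)],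
        forall g, continuous (W g),
        forall g y, orbit_class S x y -> W g (delta y) = delta (path_act S g y),
        forall m y, orbit_class S x y ->
          (sc m <> origin y -> V m (delta y) = 0) /\
          (forall z, infinite_path setT z -> is_concat m y z ->
            V m (delta y) = dual_appT F (degZ (deg m)) *: delta z) &
        forall m g n, sc m = act S g (sc n) ->
          forall xi, pi (s m ** u g ** star (s n)) xi = V m (W g (Vs n xi))]].

Definition tails k (L : kGraph k) : choiceType := set_type (@maximal_tail k L).

Definition tail_dual (R : realType) (G : groupType) k (L : kGraph k)
    (S : selfSimilar G L) (T : tails L) : topologicalType :=
  dual R (Per S (Hgraph S (set_val T))).

Definition tail_characters (R : realType) (G : groupType) k (L : kGraph k)
    (S : selfSimilar G L) : topologicalType := {T : tails L & tail_dual R S T}.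

Definition homeomorphism (X Y : topologicalType) (f : X -> Y) : Prop :=
  continuous f /\
  exists g : Y -> X, [/\ cancel f g, cancel g f & continuous g].

(* Main.v *)
Require Import Defs.
From HB Require Import structures.
From mathcomp Require Import all_boot all_order all_algebra.
From mathcomp Require Import sesquilinear complex.
From mathcomp Require Import all_classical all_reals all_analysis.
From mathcomp Require Import ring lra.

(** Let [T] be the maximal tail, [P] the group of periods and [K_f] the kernel
    attached to a character [f] of [P]. The tail of any infinite path is a maximal
    tail, so [T] consists of all vertices, every infinite path is cofinal, and
    [K_f] may be computed on the orbit of any infinite path. Two facts give the
    two continuities.

    Continuity of [Phi]: closed sets of primitive ideals are intersections of
    sets of the form [{I | a \in I}], so it must be shown that the characters [f]
    with [a] in [K_f] form a closed set. On characters [F] of [Z^k], the matrix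
    coefficients of the representation [pi_(F, x)] at a generator are constant
    multiples of a value of [F] ([gen_coefficient]), and representations are
    contractive ([rep_contraction]); so the coefficients at [a] are uniform limits
    of trigonometric polynomials in [F], and the characters [F] whose
    representation kills [a] form a closed set ([kernel_closed]). The dual of
    [Z^k] is compact and each [f] extends to [Z^k], hence the restrictions of these
    [F] to [P] form a closed set as well ([closed_restriction]). Extension uses
    that [P] is closed under differences, which holds because all periods are
    realized at one vertex ([Per_subgroup]), and that the circle is divisible
    ([char_generator]).

    Continuity of the inverse: the topology of the dual of [P] is that of pointwise
    convergence, so it suffices that [f z] depends continuously on [K_f] for each
    period [z]. Let [z = d(m) - d(n)] for a cycline pair [(m, n)]. Since [m y = n y]
    for all infinite paths [y], the partial isometry [s_m s_n^*] acts as [f z] times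
    the projection [s_n s_n^*]. Given [w0] on the circle and [g < 1], there is an
    element [a] that acts as twice the positive part of [Re (f z / w0) - g] times
    this projection ([arc_element]): it belongs to [K_f] exactly when [f z] is
    outside an arc around [w0], and the ideals not containing [a] form an open set.
    The positive part requires an absolute value. On the circle
    [|Re v - Re c| = |v - c| |v - c^-1| / 2], and [|v - c| / 2] is the square root of
    [1 - |v + c| ^ 2 / 4], which the iteration [t |-> (b + t ^ 2) / 2] produces by
    elementary estimates ([sqrt_iter_step]). The same iteration yields the
    contractivity of representations, so no spectral theory is involved. *)

Set Implicit Arguments.
Unset Strict Implicit.
Unset Printing Implicit Defensive.

Import Order.TTheory GRing.Theory Num.Theory.
Import numFieldNormedType.Exports.

Local Open Scope classical_set_scope.
Local Open Scope ring_scope.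

Local Notation kcomp := Defs.kcomp.
Local Notation family := Defs.family.

(** * Degrees and factorizations *)

Section Degrees.
Variable k : nat.
Implicit Types p q r : degree k.

Definition dsub p q : degree k := [ffun i => (p i - q i)%N].

Lemma daddK p q : dsub (p + q) p = q.
Proof. by apply/ffunP => i; rewrite !ffunE; exact: addKn. Qed.

Lemma daddI p q r : p + q = p + r -> q = r.
Proof. by move=> e; rewrite -(daddK p q) e daddK. Qed.

Lemma dsubK p q : dle p q -> p + dsub q p = q.
Proof. by move=> /forallP h; apply/ffunP => i; rewrite !ffunE; exact: subnKC. Qed.

Lemma dle_addr p q : dle p (p + q).
Proof. by apply/forallP => i; rewrite !ffunE; exact: leq_addr. Qed.

Lemma dle_trans p q r : dle p q -> dle q r -> dle p r.
Proof.
move=> /forallP pq /forallP qr; apply/forallP => i.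
exact: leq_trans (pq i) (qr i).
Qed.

Definition ddiag (n : nat) : degree k := [ffun=> n].

Lemma dle_diag p : exists n, dle p (ddiag n).
Proof.
exists (\sum_i p i)%N; apply/forallP => i.
by rewrite ffunE (bigD1 i)//= leq_addr.
Qed.

Lemma ddiag_le m n : (m <= n)%N -> dle (ddiag m) (ddiag n).
Proof. by move=> mn; apply/forallP => i; rewrite !ffunE. Qed.

Lemma degZD p q : degZ (p + q) = degZ p + degZ q.
Proof. by apply/ffunP => i; rewrite !ffunE PoszD. Qed.

End Degrees.

Section Factorization.
Variables (k : nat) (L : kGraph k).
Implicit Types a b l m n v w : L.

Lemma deg_rg m : deg (rg m) = 0.
Proof.
have := kg_deg (kg_sc_rg m); rewrite kg_comp_id => e.
by apply/esym; apply: (@daddI _ (deg m)); rewrite addr0 addrC.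
Qed.

Lemma deg_sc m : deg (sc m) = 0.
Proof. by rewrite -kg_rg_sc deg_rg. Qed.

Lemma kcompI (a b a' b' : L) : sc a = rg b -> sc a' = rg b' -> deg a = deg a' ->
  kcomp a b = kcomp a' b' -> a = a' /\ b = b'.
Proof.
move=> ab a'b' d e.
have [c [_ cU]] := @kg_fact _ L _ _ _ (kg_deg ab).
have d' : deg b' = deg b.
  by apply: (@daddI _ (deg a)); rewrite -(kg_deg ab) {1}d -kg_deg// e.
have h1 : c = (a, b) by apply: cU.
have h2 : c = (a', b') by apply: cU.
by move: h2; rewrite h1 => -[].
Qed.

Lemma rg_id v : deg v = 0 -> rg v = v.
Proof.
move=> d; have [] // := @kcompI (rg v) v v (sc v).
- exact: kg_sc_rg.
- by rewrite kg_rg_sc.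
- by rewrite deg_rg.
- by rewrite kg_comp_id kg_id_comp.
Qed.

Lemma sc_id v : deg v = 0 -> sc v = v.
Proof. by move=> dv; rewrite -{1}(rg_id dv) kg_sc_rg rg_id. Qed.

Lemma factor m p q : deg m = p + q ->
  exists a b, [/\ sc a = rg b, deg a = p, deg b = q & m = kcomp a b].
Proof. by move=> /kg_fact[[a b] [? _]]; exists a, b. Qed.

Definition prefix m n := exists e, sc m = rg e /\ n = kcomp m e.

Lemma prefix_trans l m n : prefix l m -> prefix m n -> prefix l n.
Proof.
move=> [e [se ->]] [e' [se' ->]]; move: se'; rewrite kg_sc_comp// => se'.
by exists (kcomp e e'); rewrite kg_rg_comp// kg_compA.
Qed.

Lemma prefix_refl m : prefix m m.
Proof. by exists (sc m); rewrite kg_rg_sc kg_id_comp. Qed.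

Lemma prefix_exists m p : dle p (deg m) -> exists2 a, deg a = p & prefix a m.
Proof.
move=> /dsubK/esym/factor[a [b [ab da db ->]]].
by exists a => //; exists b.
Qed.

(** A factorization of the longer prefix refines to a factorization of [m],
    and factorizations of [m] with given degrees are unique. *)
Lemma prefix_le a b m : prefix a m -> prefix b m -> dle (deg a) (deg b) ->
  prefix a b.
Proof.
move=> [e [ae mE]] [e' [be' mE']] ab.
have [c [c' [cc' dc dc' bE]]] := factor (esym (dsubK ab)).
have c'e' : sc c' = rg e' by rewrite -be' bE kg_sc_comp.
have [] : a = c /\ e = kcomp c' e'; last by move=> -> _; exists c'.
by apply: kcompI; rewrite ?kg_rg_comp// -mE kg_compA// -bE.
Qed.

Lemma prefix_eq a b m : prefix a m -> prefix b m -> deg a = deg b -> a = b.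
Proof.
move=> [e [ae mE]] [e' [be' mE']] d.
by have [] := @kcompI a e b e' ae be' d; rewrite -?mE.
Qed.

Lemma reaches_trans u v w : reaches u v -> reaches v w -> reaches u w.
Proof.
move=> [a [ru sv]] [b [rv sw]]; exists (kcomp a b).
by rewrite kg_rg_comp ?kg_sc_comp ?sv ?rv.
Qed.

Lemma reaches_refl v : deg v = 0 -> reaches v v.
Proof. by move=> d; exists v; rewrite rg_id ?sc_id. Qed.

End Factorization.

(** * Infinite paths *)

Section InfinitePaths.
Variables (k : nat) (L : kGraph k).
Implicit Types (l m v w : L) (x y z : omega k -> L) (p q r t : degree k).

(** Indexing a segment by its start and its length reaches every pair [p <= q]
    without carrying a proof of [p <= q]. *)
Definition piece x p r : L := x (seg (dle_addr p r)).

Lemma path_irr x (a b : omega k) : val a = val b -> x a = x b.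
Proof. by move=> /val_inj ->. Qed.

Lemma pieceE x p q (h : dle p q) : x (seg h) = piece x p (dsub q p).
Proof. by apply: path_irr => /=; rewrite dsubK. Qed.

Lemma path_ext x y : (forall p r, piece x p r = piece y p r) -> x = y.
Proof.
by move=> e; apply/funext => -[[p q] h]; have := e p (dsub q p); rewrite -!pieceE.
Qed.

Lemma initialE x p : initial x p = piece x 0 p.
Proof. by apply: path_irr => /=; rewrite add0r. Qed.

Lemma originE x : origin x = piece x 0 0.
Proof. exact: initialE. Qed.

Lemma piece_shift q x p r : piece (path_shift q x) p r = piece x (q + p) r.
Proof. by rewrite /piece/path_shift; apply: path_irr => /=; rewrite addrA. Qed.

Section OnePath.
Variables (D : set L) (x : omega k -> L) (Dx : infinite_path D x).

Lemma piece_in p r : D (piece x p r).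
Proof. by case: Dx => + _ _ _ _; apply. Qed.

Lemma deg_piece p r : deg (piece x p r) = r.
Proof. by case: Dx => _ h _ _ _; exact: daddI (h _ _ _). Qed.

Lemma rg_piece p r : rg (piece x p r) = piece x p 0.
Proof.
case: Dx => _ _ h _ _.
have e : dle p p by have := dle_addr p 0; rewrite addr0.
by rewrite (h _ _ _ e); apply: path_irr; rewrite /= addr0.
Qed.

Lemma sc_piece p r : sc (piece x p r) = piece x (p + r) 0.
Proof.
case: Dx => _ _ _ h _.
have e : dle (p + r) (p + r) by have := dle_addr (p + r) 0; rewrite addr0.
by rewrite (h _ _ _ e); apply: path_irr; rewrite /= addr0.
Qed.

Lemma piece_cat p r t :
  piece x p (r + t) = kcomp (piece x p r) (piece x (p + r) t).
Proof.
case: Dx => _ _ _ _ h.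
have e : dle p ((p + r) + t) by rewrite -addrA dle_addr.
by rewrite -(h _ _ _ _ _ e); apply: path_irr; rewrite /= addrA.
Qed.

Lemma piece_prefix p r t : prefix (piece x p r) (piece x p (r + t)).
Proof.
by exists (piece x (p + r) t); rewrite sc_piece rg_piece piece_cat.
Qed.

Lemma piece_prefix_le p q r : dle q r -> prefix (piece x p q) (piece x p r).
Proof. by move=> /dsubK <-; exact: piece_prefix. Qed.

End OnePath.

Lemma infinite_path_setT D x : infinite_path D x -> infinite_path setT x.
Proof. by case=> *; split. Qed.

(** Reduces the construction of an infinite path to equations between total
    functions of a start and a length. *)
Lemma path_of_pieces (D : set L) (f : degree k -> degree k -> L) :
  (forall p r, D (f p r)) ->
  (forall p r, deg (f p r) = r) -> (forall p r, rg (f p r) = f p 0) ->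
  (forall p r, sc (f p r) = f (p + r) 0) ->
  (forall p r t, f p (r + t) = kcomp (f p r) (f (p + r) t)) ->
  exists2 x, infinite_path D x & forall p r, piece x p r = f p r.
Proof.
move=> fD fd fr fs fc.
have s0 p : dsub p p = 0 by apply/ffunP => i; rewrite !ffunE subnn.
pose x : omega k -> L := fun pq => f (val pq).1 (dsub (val pq).2 (val pq).1).
exists x; last by move=> p r; rewrite /piece/x/= daddK.
split.
- by move=> pq; exact: fD.
- by move=> p q h; rewrite /x/= fd dsubK.
- by move=> p q h hp; rewrite /x/= fr s0.
- by move=> p q h hq; rewrite /x/= fs s0 dsubK.
- move=> p q t h h' h''; rewrite /x/= -[in RHS](dsubK h) daddK -fc.
  congr (f _ _); apply: (@daddI _ p); rewrite dsubK// addrA !dsubK//.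
Qed.

Lemma shift_path D q x : infinite_path D x -> infinite_path D (path_shift q x).
Proof.
move=> Dx; have [||||| y Dy yE] :=
  @path_of_pieces D (fun p r => piece x (q + p) r).
- by move=> *; exact: piece_in.
- by move=> *; exact: deg_piece Dx _ _.
- by move=> *; exact: rg_piece Dx _ _.
- by move=> p r; rewrite (sc_piece Dx) addrA.
- by move=> p r t; rewrite (piece_cat Dx) addrA.
- suff -> : path_shift q x = y by [].
  by apply: path_ext => p r; rewrite yE piece_shift.
Qed.

Lemma path_shiftD p q x :
  path_shift p (path_shift q x) = path_shift (q + p) x.
Proof. by apply: path_ext => a b; rewrite !piece_shift addrA. Qed.

(** A finite path determines its prefixes, so it is enough that the initial
    segments agree cofinally often. *)
Lemma path_ext_initial x y : infinite_path setT x -> infinite_path setT y ->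
  (forall n, exists2 q, dle (ddiag k n) q & piece x 0 q = piece y 0 q) -> x = y.
Proof.
move=> ix iy e; apply: path_ext => p r.
have e' q : piece x 0 q = piece y 0 q.
  have [n hn] := dle_diag q; have [t /(dle_trans hn) qt xy] := e n.
  apply: (@prefix_eq _ _ _ _ (piece x 0 t)).
  - exact: (piece_prefix_le ix).
  - by rewrite xy; exact: (piece_prefix_le iy).
  - by rewrite (deg_piece ix) (deg_piece iy).
have /kcompI[] : kcomp (piece x 0 p) (piece x (0 + p) r)
  = kcomp (piece y 0 p) (piece y (0 + p) r).
- by rewrite -(piece_cat ix) -(piece_cat iy) e'.
- by rewrite (sc_piece ix) (rg_piece ix).
- by rewrite (sc_piece iy) (rg_piece iy).
- by rewrite e'.
- by rewrite !add0r.
Qed.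

(** The segment of length [r] at [p] is cut out of any long enough member of the
    chain; two such members agree on it because one is a prefix of the other. *)
Lemma path_of_chain (lam : nat -> L) :
  (forall j, prefix (lam j) (lam j.+1)) ->
  (forall p, exists j, dle p (deg (lam j))) ->
  exists2 x, infinite_path setT x & forall j, piece x 0 (deg (lam j)) = lam j.
Proof.
move=> lamS lam_cof.
have lam_le i j : (i <= j)%N -> prefix (lam i) (lam j).
  move=> /subnK <-; elim: (j - i)%N => [|n IH]; first exact: prefix_refl.
  exact: prefix_trans IH (lamS _).
have /choice[ini iniP] : forall p, exists a, deg a = p /\
    exists j, prefix a (lam j).
  move=> p; have [j pj] := lam_cof p; have [a da aj] := prefix_exists pj.
  by exists a; split=> //; exists j.
have ini_pre p j : dle p (deg (lam j)) -> prefix (ini p) (lam j).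
  move=> pj; have [dp [i ip]] := iniP p.
  apply: (@prefix_le _ _ _ _ (lam (maxn i j))); last by rewrite dp.
    by apply: prefix_trans ip _; exact/lam_le/leq_maxl.
  exact/lam_le/leq_maxr.
have ini_le p r : prefix (ini p) (ini (p + r)).
  have [j prj] := lam_cof (p + r).
  apply: (@prefix_le _ _ _ _ (lam j)); rewrite ?(iniP _).1 ?dle_addr//.
    by apply: ini_pre; apply: dle_trans (dle_addr _ _) prj.
  exact: ini_pre.
have /choice[f' f'P] : forall pr, exists e,
    sc (ini pr.1) = rg e /\ ini (pr.1 + pr.2) = kcomp (ini pr.1) e.
  by move=> [p r]; exact: ini_le.
pose f p r := f' (p, r).
have fP p r : sc (ini p) = rg (f p r) /\ ini (p + r) = kcomp (ini p) (f p r).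
  exact: (f'P (p, r)).
have fd p r : deg (f p r) = r.
  apply: (@daddI _ p); rewrite -{1}(iniP p).1 -kg_deg; last exact: (fP p r).1.
  by rewrite -(fP p r).2 (iniP _).1.
have f0 p : f p 0 = sc (ini p).
  by rewrite (fP p 0).1 rg_id ?fd.
have fs p r t : sc (f p r) = rg (f (p + r) t).
  by rewrite -(fP (p + r) t).1 (fP p r).2 kg_sc_comp//; exact: (fP p r).1.
have [||||| x ix xE] := @path_of_pieces setT f.
- by [].
- by [].
- by move=> p r; rewrite f0 -(fP p r).1.
- by move=> p r; rewrite (fs p r 0) rg_id ?fd.
- move=> p r t.
  have fpr := (fP p r).1.
  suff [] : ini p = ini p /\ f p (r + t) = kcomp (f p r) (f (p + r) t) by [].
  apply: kcompI => //; rewrite ?kg_rg_comp ?fs//; first exact: (fP _ _).1.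
  rewrite -(fP _ _).2 addrA (fP _ _).2 {1}(fP p r).2 kg_compA//.
exists x => // j; rewrite xE.
have ini0 : deg (ini 0) = 0 := (iniP 0).1.
have -> : f 0 (deg (lam j)) = ini (deg (lam j)).
  rewrite -[in RHS](add0r (deg _)) (fP 0 _).2 -[in RHS](sc_id ini0).
  by rewrite (fP 0 (deg (lam j))).1 kg_comp_id.
apply: (@prefix_eq _ _ _ _ (lam j)); rewrite ?(iniP _).1//.
  by apply: ini_pre; apply/forallP.
exact: prefix_refl.
Qed.

(** Without sources, a path can be prolonged by the degree [(1, ..., 1)]
    indefinitely. *)
Lemma path_exists v : deg v = 0 ->
  exists2 x, infinite_path setT x & origin x = v.
Proof.
move=> dv.
have step m : exists n, prefix m n /\ deg n = deg m + ddiag k 1.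
  have [e [re de]] := kg_source_free (ddiag k 1) (deg_sc m).
  exists (kcomp m e); split; first by exists e; rewrite re.
  by rewrite kg_deg ?re// de.
have [nxt nxtP] := choice step.
pose lam n := iter n nxt v.
have dlam n : deg (lam n) = ddiag k n.
  elim: n => [|n IH]; first by rewrite /= dv; apply/ffunP => i; rewrite !ffunE.
  rewrite /= (nxtP _).2 [deg _]IH; apply/ffunP => i.
  by rewrite !ffunE; exact: addn1.
have [||x ix xE] := @path_of_chain lam.
- by move=> j; exact: (nxtP _).1.
- by move=> p; have [n pn] := dle_diag p; exists n; rewrite dlam.
by exists x => //; rewrite originE; have := xE 0%N; rewrite /= dv.
Qed.

Lemma is_concatP m x y : is_concat m x y <->
  piece y 0 (deg m) = m /\ forall p r, piece y (deg m + p) r = piece x p r.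
Proof.
rewrite /is_concat initialE; split=> -[-> e]; split=> //.
  by move=> p r; rewrite -e piece_shift.
by apply: path_ext => p r; rewrite piece_shift.
Qed.

Lemma concat_sc m x y : infinite_path setT y -> is_concat m x y ->
  sc m = origin x.
Proof.
move=> iy /is_concatP[ym yx]; rewrite originE -yx addr0 -[in LHS]ym.
by rewrite (sc_piece iy) add0r.
Qed.

Lemma concat_initial m x y p : infinite_path setT y -> is_concat m x y ->
  piece y 0 (deg m + p) = kcomp m (piece x 0 p).
Proof.
move=> iy /is_concatP[ym yx].
by rewrite (piece_cat iy) ym add0r -yx addr0.
Qed.

Lemma concat_unique m x y y' : infinite_path setT y -> infinite_path setT y' ->
  is_concat m x y -> is_concat m x y' -> y = y'.
Proof.
move=> iy iy' my my'; apply: path_ext_initial => // n.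
exists (deg m + ddiag k n); first by rewrite addrC dle_addr.
by rewrite (concat_initial _ iy my) (concat_initial _ iy' my').
Qed.

(** The products of [m] with the initial segments of [x] form a chain whose
    limit is the concatenation. *)
Lemma concat_exists m x : infinite_path setT x -> sc m = origin x ->
  exists2 y, infinite_path setT y & is_concat m x y.
Proof.
rewrite originE => ix mx.
pose lam n := kcomp m (piece x 0 (ddiag k n)).
have mxp p : sc m = rg (piece x 0 p) by rewrite (rg_piece ix).
have dlam n : deg (lam n) = deg m + ddiag k n by rewrite kg_deg ?(deg_piece ix).
have lam_pre q q' : dle q q' ->
    prefix (kcomp m (piece x 0 q)) (kcomp m (piece x 0 q')).
  move=> /(piece_prefix_le ix 0)[e [se ->]]; exists e.
  by rewrite kg_sc_comp// kg_compA.
have [||y iy yE] := @path_of_chain lam.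
- by move=> j; apply: lam_pre; exact: ddiag_le.
- move=> p; have [n pn] := dle_diag p; exists n; rewrite dlam.
  by apply: dle_trans pn _; rewrite addrC dle_addr.
have yq q : piece y 0 (deg m + q) = kcomp m (piece x 0 q).
  have [n qn] := dle_diag q; apply: (@prefix_eq _ _ _ _ (lam n)).
  - rewrite -(yE n) dlam; apply: (piece_prefix_le iy).
    exact: dle_add2l.
  - exact: lam_pre.
  - by rewrite (deg_piece iy) kg_deg ?(deg_piece ix).
have y0 : piece y 0 (deg m) = m.
  by have := yq 0; rewrite addr0 -mx kg_id_comp.
exists y => //; split; first by rewrite initialE.
apply: path_ext_initial => //; first exact: shift_path.
move=> n; exists (ddiag k n); first by apply/forallP.
rewrite piece_shift addr0; have := yq (ddiag k n).
rewrite (piece_cat iy) y0 add0r => /kcompI[]//.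
by rewrite (rg_piece iy) -[in LHS]y0 (sc_piece iy) add0r.
Qed.

End InfinitePaths.
Lemma concat_kcomp k (L : kGraph k) (l m : L) (x y : omega k -> L) :
  infinite_path setT y -> sc l = rg m ->
  is_concat (kcomp l m) x y <->
  is_concat l (path_shift (deg l) y) y /\
  is_concat m x (path_shift (deg l) y).
Proof.
move=> iy lm; rewrite !is_concatP kg_deg// piece_shift addr0.
rewrite (piece_cat iy) add0r; split=> [[e xy]|[[e1 _] [e2 xy]]].
  have [||<- <-] := kcompI _ lm _ e; rewrite ?(deg_piece iy)//.
    by rewrite (sc_piece iy) (rg_piece iy) add0r.
  split; split=> // p r; first by rewrite piece_shift.
  by rewrite piece_shift addrA xy.
rewrite e1 e2; split=> // p r.
by rewrite -addrA -piece_shift xy.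
Qed.

(** * The action on infinite paths *)

Section PathAction.
Variables (G : groupType) (k : nat) (L : kGraph k) (S : selfSimilar G L).
Hypothesis FV : condFV S.
Implicit Types (x y z : omega k -> L) (g h : G).

Lemma piece_act g x p r :
  piece (path_act S g x) p r = act S (res S g (piece x 0 p)) (piece x p r).
Proof. by rewrite -initialE. Qed.

Lemma act_piece0 g x p : infinite_path setT x ->
  act S g (piece x p 0) = piece x p 0.
Proof. by move=> ix; apply: FV; rewrite /vertices/= (deg_piece ix). Qed.

(** The source of a segment and the range of the next one are acted on by
    different elements of [G]; they still agree, as every vertex is fixed. *)
Lemma act_path g x :
  infinite_path setT x -> infinite_path setT (path_act S g x).
Proof.
move=> ix; have [||||| y iy yE] := @path_of_pieces _ _ setT
  (fun p r => act S (res S g (piece x 0 p)) (piece x p r)).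
- by [].
- by move=> p r; rewrite act_deg (deg_piece ix).
- by move=> p r; rewrite act_rg (rg_piece ix).
- by move=> p r; rewrite act_sc (sc_piece ix) !act_piece0.
- move=> p r t; have e : sc (piece x p r) = rg (piece x (p + r) t).
    by rewrite (sc_piece ix) (rg_piece ix).
  rewrite (piece_cat ix) act_comp//; congr (kcomp _ (act S _ _)).
  rewrite (piece_cat ix 0) add0r res_comp//.
  by rewrite (sc_piece ix) (rg_piece ix) add0r.
- suff -> : path_act S g x = y by [].
  by apply: path_ext => p r; rewrite yE piece_act.
Qed.

Lemma path_act1 x : path_act S 1%g x = x.
Proof. by apply: path_ext => p r; rewrite piece_act res_1 act_1. Qed.

Lemma initial_act g x p : infinite_path setT x ->
  piece (path_act S g x) 0 p = act S g (piece x 0 p).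
Proof. by move=> ix; rewrite piece_act res_vertex// (deg_piece ix). Qed.

Lemma path_actM g h x : infinite_path setT x ->
  path_act S (g * h)%g x = path_act S g (path_act S h x).
Proof.
move=> ix; apply: path_ext => p r.
by rewrite (piece_act g) initial_act// !piece_act res_M act_M.
Qed.

Lemma path_act_shift g x q : infinite_path setT x ->
  path_shift q (path_act S g x)
  = path_act S (res S g (piece x 0 q)) (path_shift q x).
Proof.
move=> ix; apply: path_ext => p r.
rewrite !(piece_act, piece_shift) addr0 (piece_cat ix) add0r res_comp//.
by rewrite (sc_piece ix) (rg_piece ix) add0r.
Qed.

Lemma orbit_path x y : orbit_class S x y -> infinite_path setT y.
Proof. by case. Qed.

Lemma orbit_refl x : infinite_path setT x -> orbit_class S x x.
Proof. by move=> ix; split=> //; exists 0, 0, 1%g; rewrite path_act1. Qed.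

Lemma orbit_concat x m y z : infinite_path setT z -> is_concat m y z ->
  orbit_class S x y -> orbit_class S x z.
Proof.
move=> iz [_ zy] [iy [p [q [g e]]]]; split=> //.
by exists p, (deg m + q), g; rewrite e -zy path_shiftD.
Qed.

Lemma orbit_uncat x m y z : infinite_path setT x -> infinite_path setT y ->
  is_concat m y z -> orbit_class S x z -> orbit_class S x y.
Proof.
move=> ix iy [_ zy] [iz [p [q [g e]]]]; split=> //.
exists (p + deg m), q, (res S g (piece (path_shift q z) 0 (deg m))).
rewrite -path_shiftD e path_act_shift; last exact: shift_path.
by rewrite -zy !path_shiftD addrC.
Qed.

(** If [h] relates the tails of [x] and [y], then [h] times the inverse of the
    restriction of [g] relates those of [x] and [g y]. *)
Lemma orbit_act x g y : orbit_class S x y -> orbit_class S x (path_act S g y).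
Proof.
move=> [iy [p [q [h e]]]]; split; first exact: act_path.
have iq : infinite_path setT (path_shift q y) by exact: shift_path.
exists p, q, (h * (res S g (piece y 0 q))^-1)%g.
rewrite path_act_shift// -path_actM//.
by rewrite -mulgA mulVg mulg1.
Qed.

(** * Cycline pairs *)

Lemma cycline_pairP (D : set L) m n : cycline_pair S D m n <->
  [/\ D m, D n, sc m = sc n & forall x, infinite_path D x -> origin x = sc n ->
    exists y, [/\ infinite_path D y, is_concat m x y & is_concat n x y]].
Proof.
by rewrite /cycline_pair /cycline act_1; split=> -[Dm Dn mn h]; split=> // x ix ox;
  have := h x ix ox; rewrite path_act1.
Qed.

Lemma cycline_sym D m n : cycline_pair S D m n -> cycline_pair S D n m.
Proof.
move=> /cycline_pairP[Dm Dn mn h]; apply/cycline_pairP; split=> // x ix.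
by rewrite mn => /(h _ ix)[y [? ? ?]]; exists y.
Qed.

Lemma cycline_trans D l m n :
  cycline_pair S D l m -> cycline_pair S D m n -> cycline_pair S D l n.
Proof.
move=> /cycline_pairP[Dl Dm lm h] /cycline_pairP[_ Dn mn h'].
apply/cycline_pairP; rewrite lm; split=> // x ix ox.
have [y [iy ly my]] := h x ix (etrans ox (esym mn)).
have [y' [iy' my' ny']] := h' x ix ox.
exists y; split=> //; suff -> : y = y' by [].
by apply: (concat_unique _ _ my my'); [move: iy|move: iy'];
  exact: infinite_path_setT.
Qed.

Lemma cycline_rg m n : cycline_pair S setT m n -> rg m = rg n.
Proof.
move=> /cycline_pairP[_ _ mn h]; have [x ix xn] := path_exists (deg_sc n).
have [y [iy /is_concatP[my _] /is_concatP[ny _]]] := h x ix xn.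
by rewrite -my -ny !(rg_piece iy).
Qed.

Lemma cycline_kcompl l m n : sc l = rg m -> cycline_pair S setT m n ->
  cycline_pair S setT (kcomp l m) (kcomp l n).
Proof.
move=> lm mn; have ln : sc l = rg n by rewrite -(cycline_rg mn).
move/cycline_pairP: mn => -[_ _ mn h]; apply/cycline_pairP.
rewrite !kg_sc_comp//; split=> // x ix ox.
have [y [iy my ny]] := h x ix ox.
have ly : sc l = origin y.
  by rewrite lm originE; move/is_concatP: my => -[<- _]; rewrite (rg_piece iy).
have [z iz lz] := concat_exists iy ly.
exists z; have zy : path_shift (deg l) z = y by case: lz.
by split=> //; apply/concat_kcomp; rewrite ?zy.
Qed.

Lemma cycline_cancel l m n : sc l = rg m -> sc l = rg n ->
  cycline_pair S setT (kcomp l m) (kcomp l n) -> cycline_pair S setT m n.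
Proof.
move=> lm ln /cycline_pairP[_ _]; rewrite !kg_sc_comp// => mn h.
apply/cycline_pairP; split=> // x ix ox; have [y [iy ly1 ly2]] := h x ix ox.
move: ly1 ly2 => /(concat_kcomp _ iy lm)[_ my] /(concat_kcomp _ iy ln)[_ ny].
by exists (path_shift (deg l) y); split=> //; exact: shift_path.
Qed.

(** Both members of a cycline pair are initial segments of one infinite path. *)
Lemma cycline_prefix l m n : prefix l m -> dle (deg l) (deg n) ->
  cycline_pair S setT m n -> prefix l n.
Proof.
move=> lm ln /cycline_pairP[_ _ mn h]; have [x ix xn] := path_exists (deg_sc n).
have [y [iy /is_concatP[my _] /is_concatP[ny _]]] := h x ix xn.
apply: (@prefix_le _ _ _ _ (piece y 0 (deg m + deg n))) => //.
  by apply: prefix_trans lm _; rewrite -{1}my; exact: (piece_prefix iy).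
by rewrite addrC -{1}ny; exact: (piece_prefix iy).
Qed.

End PathAction.

(** * The periodicity group *)

Section Periodicity.
Variables (G : groupType) (k : nat) (L : kGraph k) (S : selfSimilar G L).
Variable T : set L.
Hypothesis TE : T = @vertices k L.

Let H := Hset S T.
Let D := Hgraph S T.

Lemma tail_vertex (v : L) : deg v = 0 -> T v.
Proof. by rewrite TE. Qed.

Lemma tail_graphT : tail_graph T = setT.
Proof.
by apply/seteqP; split=> // m _; apply: tail_vertex; exact: deg_sc.
Qed.

(** Let [l] lead from [v] to [w]. The partner of [l m] at [v] begins with [l],
    since the two lie on one infinite path, and what remains of it is the
    partner of [m] at [w]. Prepending [l] to any partner of [m] shows that
    there is only one. *)
Lemma Hset_hereditary v w : H v -> reaches v w -> H w.
Proof.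
move=> [Tv Hv] [l [rl sl]].
split; first by apply: tail_vertex; rewrite -sl deg_sc.
move=> p q pq m [rm dm] _; have lm : sc l = rg m by rewrite rm.
have pq' : PerG S (tail_graph T) (degZ (deg l + p) - degZ (deg l + q)).
  by rewrite !degZD opprD addrACA subrr add0r.
have [|N [[[rN dN] _ cN] NU]] := Hv _ _ pq' (kcomp l m) _ (tail_vertex (deg_sc _)).
  by rewrite /paths_from/= kg_rg_comp// kg_deg// dm.
rewrite tail_graphT in cN NU *.
have [b [lb NE]] : prefix l N.
  apply: (cycline_prefix _ _ cN); first by exists m.
  by rewrite dN dle_addr.
have db : deg b = q by apply: (@daddI _ (deg l)); rewrite -kg_deg// -NE.
exists b; split=> [|b' [[rb' db'] _ mb']].
  split; [by rewrite /paths_from/= -lb sl|exact: tail_vertex (deg_sc _)|].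
  by apply: (cycline_cancel lm lb); rewrite -NE.
have lb' : sc l = rg b' by rewrite rb'.
suff /(kcompI lb lb' erefl)[] : kcomp l b = kcomp l b' by [].
rewrite -NE; apply: NU; split; last exact: cycline_kcompl.
  by rewrite /paths_from/= kg_rg_comp// kg_deg// db'.
exact: tail_vertex (deg_sc _).
Qed.

Lemma path_in_Hgraph x : infinite_path setT x -> H (origin x) ->
  infinite_path D x.
Proof.
move=> ix Hx; case: (ix) => _ *; split=> // -[[p q] h].
rewrite pieceE; split; last exact: tail_vertex (deg_sc _).
apply: Hset_hereditary Hx _; exists (piece x 0 p).
by rewrite originE !(rg_piece ix) (sc_piece ix) add0r.
Qed.

Lemma cycline_Hgraph m n :
  cycline_pair S D m n <-> H (rg n) /\ cycline_pair S setT m n.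
Proof.
rewrite !cycline_pairP; split=> [[Dm Dn mn h]|[Hn [_ _ mn h]]].
  split; first by case: Dn.
  split=> // x ix xn; have [|y [iy my ny]] := h x _ xn.
    apply: path_in_Hgraph => //; rewrite xn.
    by apply: (Hset_hereditary Dn.1); exists n.
  by exists y; split=> //; exact: infinite_path_setT iy.
have mn' : cycline_pair S setT m n by apply/cycline_pairP.
split=> //.
- by split; [rewrite (cycline_rg mn')|exact: tail_vertex (deg_sc _)].
- by split=> //; exact: tail_vertex (deg_sc _).
move=> x /infinite_path_setT ix /(h x ix)[y [iy my ny]].
exists y; split=> //; apply: path_in_Hgraph => //.
by rewrite originE; move/is_concatP: ny => -[ny _]; rewrite -ny (rg_piece iy) in Hn.
Qed.

Lemma Per_cycline z : Per S D z ->
  exists m n, cycline_pair S setT m n /\ z = degZ (deg m) - degZ (deg n).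
Proof.
by move=> [m [n [/cycline_Hgraph[_ mn] ->]]]; exists m, n.
Qed.

Lemma Per_at v p q (m : L) : H v -> Per S D (degZ p - degZ q) ->
  rg m = v -> deg m = p ->
  exists n, [/\ rg n = v, deg n = q & cycline_pair S setT m n].
Proof.
move=> [_ Hv] /Per_cycline[m' [n' [mn' e]]] rm dm.
have [|n [[[rn dn] _ mn] _]] := Hv p q _ m (conj rm dm) (tail_vertex (deg_sc _)).
  by exists m', 1%g, n'; rewrite tail_graphT.
by exists n; split=> //; rewrite tail_graphT in mn.
Qed.

(** The members of a cycline pair have their range [v] in [H]. Every period is
    realized at [v], starting from any path of the right degree, so cycline pairs
    for two periods can be chained there. *)
Lemma Per_subgroup a b : Per S D a -> Per S D b -> Per S D (a - b).
Proof.
move=> aP bP; have [m1 [n1 [/cycline_Hgraph[Hv _] aE]]] := aP.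
have [m2 [n2 [c2 bE]]] := bP.
have bP' : Per S D (degZ (deg n2) - degZ (deg m2)).
  by exists n2, m2; split; [exact: cycline_sym|].
set v := rg n1 in Hv.
have dv : deg v = 0 by rewrite /v deg_rg.
have [m [rm dm]] := kg_source_free (deg m1 + deg n2) dv.
have [|n [rn dn mn]] := @Per_at v (deg m1 + deg n2) (deg n1 + deg n2) m Hv _ rm dm.
  by rewrite !degZD opprD addrACA subrr addr0 -aE.
have [|n' [rn' dn' nn']] := @Per_at v (deg n1 + deg n2) (deg n1 + deg m2) n Hv _ rn dn.
  by rewrite !degZD opprD addrACA subrr add0r.
exists m, n'; split.
  by apply/cycline_Hgraph; rewrite rn'; split=> //; exact: cycline_trans mn nn'.
by rewrite dm dn' aE bE !degZD opprB !opprD addrACA addrC addrCA !addrA.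
Qed.

End Periodicity.

(** * Maximal tails *)

Section Tails.
Variables (k : nat) (L : kGraph k).

Definition path_tail (x : omega k -> L) : set L :=
  [set v | vertices v /\ exists p, reaches v (piece x p 0)].

(** A path that ends on [x] can be continued along [x]: this makes paths of
    every degree stay in the tail, and gives two vertices a common successor
    far along [x]. *)
Lemma path_tailP x : infinite_path setT x -> maximal_tail (path_tail x).
Proof.
move=> ix; split.
- exists (origin x); rewrite originE; split; first exact: (deg_piece ix).
  by exists 0; apply: reaches_refl; exact: (deg_piece ix).
- by move=> v [].
- move=> v w [_ [p vp]] dw wv; split=> //.
  by exists p; exact: reaches_trans vp.
- move=> v p [dv [q [l [rl sl]]]].
  have lx : sc l = rg (piece x q p) by rewrite sl (rg_piece ix).
  have [|a da [e [ae aE]]] := @prefix_exists _ _ (kcomp l (piece x q p)) p.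
    by rewrite kg_deg// (deg_piece ix) addrC dle_addr.
  exists a; split; first split=> //.
    by rewrite -rl -(kg_rg_comp lx) aE kg_rg_comp.
  split; first exact: deg_sc.
  exists (q + p), e; split=> //.
  by rewrite -(sc_piece ix) -(kg_sc_comp lx) aE kg_sc_comp.
- move=> v1 v2 [_ [p1 r1]] [_ [p2 r2]]; exists (piece x (p1 + p2) 0).
  have rx p q : reaches (piece x p 0) (piece x (p + q) 0).
    by exists (piece x p q); rewrite (rg_piece ix) (sc_piece ix).
  split; first split; first exact: (deg_piece ix).
  + exists (p1 + p2); apply: reaches_refl; exact: (deg_piece ix).
  + exact: reaches_trans r1 (rx _ _).
  + by apply: reaches_trans r2 _; rewrite addrC.
Qed.

Hypothesis one_tail : exists! T : set L, maximal_tail T.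

(** Every vertex starts an infinite path, hence lies in the maximal tail of
    that path. *)
Lemma unique_tail T : maximal_tail T -> T = @vertices k L.
Proof.
move: one_tail => [T0 [T0m T0U]] Tm; rewrite -(T0U _ Tm).
apply/seteqP; split=> [v|v dv]; first by case: T0m => _ + _ _ _; apply.
have [x ix xv] := path_exists dv; rewrite (T0U _ (path_tailP ix)); split=> //.
by exists 0; rewrite -originE xv; exact: reaches_refl.
Qed.

(** The tail of [x] is the only maximal tail, so every vertex reaches [x]. *)
Lemma path_cofinal T (x : omega k -> L) : maximal_tail T -> infinite_path setT x ->
  cofinal_path T x.
Proof.
move=> Tm ix; split.
  by rewrite (tail_graphT (unique_tail Tm)).
have -> : T = path_tail x.
  by rewrite (unique_tail Tm) (unique_tail (path_tailP ix)).
move=> v [_ [p vp]]; have h : dle p p by apply/forallP.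
by exists p, h; rewrite pieceE (_ : dsub p p = 0)// -(daddK p 0) addr0.
Qed.

End Tails.

(** * Characters *)

Local Open Scope complex_scope.

Section ComplexTopology.
Variable R : realType.
Local Notation C := R[i].

Lemma gt0_complex (e : C) : 0 < e -> exists2 r : R, 0 < r & e = r%:C.
Proof.
case: e => r c; rewrite ltcE/= => /andP[/eqP -> r0]; exists r => //.
Qed.

Lemma ge0_complex (e : C) : 0 <= e -> exists2 r : R, 0 <= r & e = r%:C.
Proof.
case: e => r c; rewrite lecE/= => /andP[/eqP -> r0]; exists r => //.
Qed.

Lemma norm_real_complex (x : R) : `|x%:C : C| = `|x|%:C.
Proof. by rewrite normc_def/= expr0n addr0 sqrtr_sqr. Qed.

Lemma real_complex_continuous : continuous ((fun x => x%:C) : R -> C^o).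
Proof.
move=> x; apply/cvgrPdist_lt => _/posnumP[e].
have [r r0 er] := gt0_complex (gt0 e).
near=> t; rewrite er -rmorphB/= [ltLHS]norm_real_complex ltcR.
by near: t; apply: (@cvgr_dist_lt _ _ _ (nbhs x) _ id) => //; exact: cvg_id.
Unshelve. all: by end_near. Qed.

(** The circle is closed in the union of the graphs of [+ sqrt (1 - t ^ 2)]
    and [- sqrt (1 - t ^ 2)] over [-1, 1]. *)
Lemma compact_circle : compact [set z : C^o | `|z| = 1].
Proof.
pose g (b : bool) (t : R) : C^o :=
  t%:C + (-1) ^+ b * ('i%C * (Num.sqrt (1 - t ^+ 2))%:C).
have gc b : continuous (g b).
  move=> t; apply: cvgD; first exact: real_complex_continuous.
  apply: cvgMr; apply: cvgMr; apply: continuous_comp; last exact: real_complex_continuous.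
  apply: continuous_comp; last exact: sqrt_continuous.
  apply: cvgB; first exact: cvg_cst.
  by apply: cvgM; exact: cvg_id.
have circle_sub : [set z : C^o | `|z| = 1]
    `<=` g false @` `[-1, 1] `|` g true @` `[-1, 1].
  move=> [a c]/=; rewrite normc_def/= => -[e].
  have e1 : a ^+ 2 + c ^+ 2 = 1.
    by rewrite -[RHS](expr1n _ 2) -e sqr_sqrtr// addr_ge0// sqr_ge0.
  have a1 : a \in `[-1, 1].
    rewrite in_itv/=; have := sqr_ge0 c; nra.
  have gE b : g b a = a +i* ((-1) ^+ b * `|c|).
    rewrite /g (_ : 1 - a ^+ 2 = c ^+ 2); last by rewrite -e1 addrC addKr.
    rewrite sqrtr_sqr; case: b; apply/eqP; rewrite eq_complex/=.
      by rewrite !(expr1, mulN1r, mul0r, mul1r, add0r, mulr0, subr0, oppr0, addr0) !eqxx.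
    by rewrite !(expr0, mul1r, mul0r, add0r, mulr0, subr0, addr0, oppr0) !eqxx.
  have [c0|c0] := leP 0 c; [left|right]; exists a => //; rewrite gE.
    by rewrite expr0 mul1r ger0_norm.
  by rewrite expr1 mulN1r ltr0_norm// opprK.
apply: subclosed_compact circle_sub.
  apply: (@closed_comp _ _ (fun z : C^o => `|z|) [set 1]).
    by move=> z _; exact: norm_continuous.
  exact: accessible_closed_set1 (hausdorff_accessible (@norm_hausdorff _ C^o)) _.
apply: compactU; apply: continuous_compact => //.
- exact: continuous_subspaceT.
- exact: segment_compact.
- exact: continuous_subspaceT.
- exact: segment_compact.
Qed.

End ComplexTopology.

Section Extension.
Variables (R : realType) (V : zmodType).
Local Notation C := R[i].

Definition subgroup (Q : set V) : Prop :=
  Q 0 /\ forall a b, Q a -> Q b -> Q (a - b).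

(** The function is total, with arbitrary values off [Q], so that [Q] can grow
    without a change of type. *)
Definition char_on (Q : set V) (f : V -> C) : Prop :=
  (forall a, Q a -> `|f a| = 1) /\
  forall a b, Q a -> Q b -> f (a + b) = f a * f b.

Section Partial.
Variables (Q : set V) (f : V -> C).
Hypotheses (gQ : subgroup Q) (cf : char_on Q f).

Lemma subgroupN a : Q a -> Q (- a).
Proof. by move=> Qa; rewrite -sub0r; apply: gQ.2 => //; case: gQ. Qed.

Lemma subgroupD a b : Q a -> Q b -> Q (a + b).
Proof. by move=> Qa /subgroupN Qb; rewrite -[b]opprK; exact: gQ.2. Qed.

Lemma subgroupMn a n : Q a -> Q (a *+ n).
Proof.
move=> Qa; elim: n => [|n IH]; first by case: gQ.
by rewrite mulrS; exact: subgroupD.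
Qed.

Lemma subgroupMz a (j : int) : Q a -> Q (a *~ j).
Proof.
by case: j => n Qa; [|apply: subgroupN]; exact: subgroupMn.
Qed.

Lemma char_on_neq0 a : Q a -> f a != 0.
Proof. by move=> Qa; rewrite -normr_eq0 cf.1// oner_eq0. Qed.

Lemma char_on0 : f 0 = 1.
Proof.
have Q0 := gQ.1; apply: (mulIf (char_on_neq0 Q0)).
by rewrite -cf.2// addr0 mul1r.
Qed.

Lemma char_onN a : Q a -> f (- a) = (f a)^-1.
Proof.
move=> Qa; apply: (mulIf (char_on_neq0 Qa)).
by rewrite -cf.2// ?addNr ?char_on0 ?mulVf ?char_on_neq0//; exact: subgroupN.
Qed.

Lemma char_onMz a (j : int) : Q a -> f (a *~ j) = f a ^ j.
Proof.
have char_onMn n : Q a -> f (a *+ n) = f a ^+ n.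
  move=> Qa; elim: n => [|n IH]; first exact: char_on0.
  by rewrite mulrS cf.2// ?IH ?exprS//; exact: subgroupMn.
case: j => n Qa; first exact: char_onMn.
by rewrite NegzE mulrNz char_onN ?char_onMn//; exact: subgroupMn.
Qed.

(** The value at a multiple of [e] is forced by the values on [Q]; when some
    multiple lies in [Q], the generator of those multiples decides it through a
    root, which exists because the circle is divisible. *)
Lemma char_generator e : exists w : C, `|w| = 1 /\
  forall j : int, Q (e *~ j) -> f (e *~ j) = w ^ j.
Proof.
have [[n n0Q]|noQ] := pselect (exists n, (0 < n)%N && `[< Q (e *+ n) >]); last first.
  exists 1; rewrite normr1; split=> // j Qj.
  suff -> : j = 0 by rewrite mulr0z char_on0.
  apply: contrapT => /eqP j0; apply: noQ; exists `|j|%N.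
  rewrite absz_gt0 j0/=; apply/asboolP; rewrite -[e *+ _]/(e *~ `|j|%N).
  have [j_ge0|j_lt0] := leP 0 j; first by rewrite gez0_abs.
  by rewrite ltz0_abs// mulrNz; exact: subgroupN.
have ex : exists n, (0 < n)%N && `[< Q (e *+ n) >] by exists n.
pose m := ex_minn ex; have [m0 Qm min_m] : [/\ (0 < m)%N, Q (e *+ m) &
    forall r, (0 < r)%N -> Q (e *+ r) -> (m <= r)%N].
  rewrite /m; case: ex_minnP => i /andP[i0 /asboolP Qi] h; split=> // r r0 Qr.
  by apply: h; rewrite r0; exact/asboolP.
exists (m.-root (f (e *+ m))); split.
  apply/eqP; rewrite -(pexpr_eq1 m0)// -normrX rootCK//.
  by apply/eqP; exact: cf.1.
move=> j Qj; have jE := divz_eq j m.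
have r_ge0 : (0 <= j %% m)%Z by rewrite modz_ge0// eqz_nat -lt0n.
have r_lt : (j %% m)%Z < m%:Z by rewrite ltz_pmod.
suff r0 : (j %% m)%Z = 0.
  rewrite jE r0 addr0 mulrC mulrzA (char_onMz _ Qm).
  by rewrite -{1}(rootCK m0 (f (e *+ m))) exprnP exprz_exp.
have Qr : Q (e *~ (j %% m)%Z).
  have -> : (j %% m)%Z = j - m%:Z * (j %/ m)%Z.
    by apply/eqP; rewrite eq_sym subr_eq addrC mulrC -jE.
  by rewrite mulrzBr mulrzA; apply: gQ.2 => //; exact: subgroupMz.
move: r_ge0 r_lt Qr; case: ((j %% m)%Z) => // r _.
rewrite ltz_nat; case: r => // r rm /(min_m _ (ltn0Sn _)).
by rewrite leqNgt rm.
Qed.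

Definition adjoin e : set V := [set a | exists b (j : int), Q b /\ a = b + e *~ j].

Lemma adjoin_subgroup e : subgroup (adjoin e).
Proof.
split; first by exists 0, 0; split; [case: gQ|rewrite mulr0z addr0].
move=> _ _ [a [i [Qa ->]]] [b [j [Qb ->]]].
exists (a - b), (i - j); split; first exact: gQ.2.
by rewrite mulrzBr opprD addrACA.
Qed.

(** The value [f b * w ^ j] at [b + e *~ j] does not depend on the
    decomposition, by the choice of [w]. *)
Lemma char_adjoin e : exists f' : V -> C,
  char_on (adjoin e) f' /\ forall a, Q a -> f' a = f a.
Proof.
have [w [w1 wP]] := char_generator e.
have w0 : w != 0 by rewrite -normr_eq0 w1 oner_eq0.
pose d a := xget (0, 0) [set bj : V * int | Q bj.1 /\ a = bj.1 + e *~ bj.2].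
pose f' a := f (d a).1 * w ^ (d a).2.
have f'E b j : Q b -> f' (b + e *~ j) = f b * w ^ j.
  move=> Qb; rewrite /f'.
  have [] : [set bj : V * int | Q bj.1 /\ b + e *~ j = bj.1 + e *~ bj.2]
      (d (b + e *~ j)) by apply: (@xgetPex _ _ _ _); exists (b, j).
  case: (d _) => b' j' /= Qb' eq.
  have eq' : e *~ (j - j') = b' - b.
    rewrite mulrzBr; apply: (addrI b); apply: (addIr (e *~ j')).
    by rewrite addrA addrNK eq subrKC.
  have bb' : b' = b + e *~ (j - j') by rewrite eq' addrC subrK.
  have Qj : Q (e *~ (j - j')) by rewrite eq'; exact: gQ.2.
  by rewrite bb' cf.2// wP// -mulrA -expfzDr// subrK.
exists f'; split; last first.
  by move=> a Qa; rewrite -[a in f' a]addr0 -(mulr0z e) f'E// expr0z mulr1.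
split=> [_ [b [j [Qb ->]]]|_ _ [a [i [Qa ->]]] [b [j [Qb ->]]]].
  rewrite f'E// normrM cf.1// mul1r.
  by case: j => n; rewrite ?NegzE -?exprnN ?normrV ?unitfE ?expf_neq0// normrX w1 expr1n ?invr1.
rewrite addrACA -mulrzDr !f'E//; last exact: subgroupD.
by rewrite cf.2// expfzDr// mulrACA.
Qed.

End Partial.

Lemma char_adjoins (Q : set V) (f : V -> C) (es : seq V) :
  subgroup Q -> char_on Q f -> exists (Q' : set V) (f' : V -> C),
  [/\ subgroup Q', char_on Q' f', forall a, Q a -> Q' a /\ f' a = f a &
      forall e, e \in es -> Q' e].
Proof.
move=> gQ cf; elim: es => [|e es [Q' [f' [gQ' cf' ff' esQ']]]].
  by exists Q, f; split.
have [f'' [cf'' ff'']] := char_adjoin gQ' cf' e.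
have sub a : Q' a -> adjoin Q' e a.
  by move=> Qa; exists a, 0; rewrite mulr0z addr0.
exists (adjoin Q' e), f''; split=> //; first exact: adjoin_subgroup.
  by move=> a /ff'[Qa <-]; split; [exact: sub|exact: ff''].
move=> a; rewrite inE => /predU1P[->|/esQ'/sub//].
by exists 0, 1; rewrite add0r; split=> //; case: gQ'.
Qed.

End Extension.

Lemma continuous_ptws (T V : topologicalType) (I : Type) (h : T -> {ptws I -> V}) :
  (forall i, continuous (fun t => h t i)) -> continuous h.
Proof.
move=> hc t; apply/cvg_sup => i.
exact: (@continuous_comp_initial _ _ _ (fun f : I -> V => f i) h (hc i) t).
Qed.

Section Duals.
Variables (R : realType) (k : nat).
Local Notation C := R[i].

Definition elt (P : set (lattice k)) z (Pz : P z) : set_type P :=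
  exist _ z (mem_set Pz).

Definition mk_dual (P : set (lattice k)) (f : set_type P -> C)
  (fP : is_character f) : dual R P := exist _ f (mem_set fP).

Lemma dualP (P : set (lattice k)) (f : dual R P) : is_character (set_val f).
Proof. exact: set_valP. Qed.

Lemma dual_ext (P : set (lattice k)) (f g : dual R P) :
  (forall z, dual_app f z = dual_app g z) -> f = g.
Proof. by move=> fg; apply: val_inj; apply/funext => z; exact: fg. Qed.

(** The standard basis of [Z^k] is adjoined to [P] one vector at a time. *)
Lemma char_extension (P : set (lattice k)) (f : dual R P) :
  (forall a b, P a -> P b -> P (a - b)) ->
  exists F : dual R [set: lattice k], extends F f.
Proof.
move=> gP.
(* The dual of an empty [P] is a point, which every character extends. *)
have [[z0 Pz0]|P0] := pselect (exists z, P z); last first.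
  have c1 : @is_character R k setT (fun=> 1).
    by split=> *; rewrite ?normr1 ?mulr1.
  by exists (mk_dual c1) => z; exfalso; apply: P0; exists (val z); exact: set_valP.
have sP : subgroup P by split=> //; rewrite -(subrr z0); exact: gP.
pose f0 z := if pselect (P z) is left h then dual_app f (elt h) else 1.
have f0E (z : set_type P) : f0 (val z) = dual_app f z.
  rewrite /f0; case: pselect => [h|[]]; last exact: set_valP.
  by congr (dual_app f _); exact: val_inj.
have [f1 fM] := dualP f.
have cf0 : char_on P f0.
  split=> [a Pa|a b Pa Pb].
    by rewrite (f0E (elt Pa)); exact: f1.
  have Pab := subgroupD sP Pa Pb.
  by rewrite (f0E (elt Pab)) (f0E (elt Pa)) (f0E (elt Pb)); exact: fM.
pose e (i : 'I_k) : lattice k := [ffun j => (j == i)%:Z].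
have [Q [f' [gQ [f'1 f'M] f'f Qe]]] :=
  char_adjoins [seq e i | i <- enum 'I_k] sP cf0.
have QT z : Q z.
  have -> : z = \sum_i e i *~ z i.
    apply/ffunP => j; rewrite sum_ffunE (bigD1 j)//= big1 ?addr0.
      by rewrite ffunMzE ffunE eqxx intz.
    by move=> i ij; rewrite ffunMzE ffunE eq_sym (negbTE ij) mul0rz.
  elim/big_ind: _ => [|a b|i _]; first by case: gQ.
    exact: subgroupD.
  by apply: subgroupMz => //; apply: Qe; apply: map_f; rewrite mem_enum.
have cF : @is_character R k setT (fun z => f' (val z)).
  by split=> [a|a b c ->]; [exact: f'1|exact: f'M].
exists (mk_dual cF) => z; rewrite -f0E -(f'f _ (set_valP z)).2 /dual_appT/dual_app.
by [].
Qed.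

Local Notation ptw Q := {ptws set_type Q -> C^o} (only parsing).

Lemma ptws_eval (Q : set (lattice k)) (z : set_type Q) :
  continuous (fun f : ptw Q => f z : C^o).
Proof. exact: (@proj_continuous (set_type Q) (fun=> C^o) z). Qed.

Lemma is_character_closed (Q : set (lattice k)) :
  closed (@is_character R k Q : set (ptw Q)).
Proof.
have cl1 (c : C^o) : closed [set c].
  exact: accessible_closed_set1 (hausdorff_accessible (@norm_hausdorff _ C^o)) _.
have -> : @is_character R k Q =
    (\bigcap_(a : set_type Q) [set f : ptw Q | `|f a : C^o| = 1]) `&`
    \bigcap_(abc in [set abc : set_type Q * set_type Q * set_type Q |
         val abc.2 = val abc.1.1 + val abc.1.2])
      [set f : ptw Q | (f abc.2 : C^o) - f abc.1.1 * f abc.1.2 = 0].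
  apply/seteqP; split=> [f [f1 fM]|f [f1 fM]]; split.
  - by move=> a _; exact: f1.
  - by move=> [[a b] c]/= abc; rewrite (fM a b c)// subrr.
  - by move=> a; exact: f1.
  - by move=> a b c abc; have /eqP := fM (a, b, c) abc; rewrite subr_eq0 => /eqP.
apply: closedI; apply: closed_bigI; [move=> a _|move=> [[a b] c] _].
  apply: (@closed_comp _ _ (fun f : ptw Q => `|f a : C^o|) [set 1]) => // f _.
  by apply: continuous_comp; [exact: ptws_eval|exact: norm_continuous].
apply: (@closed_comp _ _ (fun f : ptw Q => (f c : C^o) - f a * f b) [set 0]) => // f _.
exact: (@cvgB C C^o _ (nbhs f) _ (fun f : ptw Q => f c)
  (fun f : ptw Q => (f a : C^o) * f b) _ _ (@ptws_eval Q c f)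
  (cvgM (@ptws_eval Q a f) (@ptws_eval Q b f))).
Qed.

(** The dual of [Z^k] is compact, so a condition that is closed there remains
    closed when it is only required of some extension. *)
Lemma closed_restriction (P : set (lattice k)) (E : set (ptw [set: lattice k])) :
  E `<=` @is_character R k setT -> closed E ->
  closed [set f : dual R P | exists2 F, extends F f & E (set_val F)].
Proof.
move=> Ech Ecl.
pose rho (F : ptw [set: lattice k]) : ptw P := fun z => F (exist _ (val z) (in_setT _)).
have rho_cont : continuous rho.
  apply: continuous_ptws => z.
  exact: (@ptws_eval _ (exist _ (val z) (in_setT _))).
have Ecpt : compact E.
  apply: (subclosed_compact Ecl) (fun F EF => (Ech F EF).1).
  exact: (@tychonoff (set_type [set: lattice k]) (fun=> C^o) _
    (fun=> @compact_circle R)).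
have rcl : closed (rho @` E).
  apply: compact_closed; first exact: (@hausdorff_product _ (fun=> C^o) (fun=> @norm_hausdorff _ _)).
  exact/continuous_compact/Ecpt/continuous_subspaceT.
have -> : [set f : dual R P | exists2 F, extends F f & E (set_val F)]
    = set_val @^-1` (rho @` E).
  apply/seteqP; split=> [f [F Ff EF]|f [F EF Ff]]/=.
    by exists (set_val F) => //; apply/funext => z; exact: Ff.
  exists (mk_dual (Ech _ EF)) => // z.
  by rewrite /dual_app -Ff.
by apply: closed_comp => // f _; exact: initial_continuous.
Qed.

End Duals.

(** * Square roots in a C*-algebra *)

Section Domination.
Variable R : realType.
Local Notation C := R[i].

Lemma dominated_cvg (V : completeNormedModType C) (u : nat -> V) (t : nat -> R) :
  (forall n, `|u n.+1 - u n| <= (t n.+1 - t n)%:C) -> cvgn t -> cvgn u.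
Proof.
move=> ut /cvgrPdist_lt tl.
have dom n m : `|u (m + n)%N - u n| <= (t (m + n)%N - t n)%:C.
  elim: m => [|m IH]; first by rewrite !subrr normr0.
  rewrite addSn -(subrK (u (m + n)%N) (u _.+1)) -addrA.
  apply: le_trans (ler_normD _ _) _.
  rewrite -(subrK (t (m + n)%N) (t _.+1)) -addrA rmorphD/=.
  exact: lerD.
apply: cauchy_cvg; apply: cauchy_exP => e /gt0_complex[r r0 ->].
have [N _ hN] := tl (r / 2) ltac:(by rewrite divr_gt0).
exists (u N); exists N => // n /= Nn; rewrite -ball_normE /ball_/= distrC.
rewrite -(subnK Nn); apply: le_lt_trans (dom _ _) _; rewrite ltcR subnK//.
have := hN _ Nn; have := hN N (leqnn N); rewrite !ltr_norml; lra.
Qed.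

Lemma eq0_small (V : normedModType C) (a : V) (c : R) :
  (forall e : R, 0 < e -> `|a| <= (c * e)%:C) -> a = 0.
Proof.
move=> h; apply/eqP; rewrite -normr_eq0.
have [r r0 ar] := ge0_complex (normr_ge0 a); rewrite ar.
rewrite -[0]/(0%:C) (inj_eq (@complexI R)); apply: contraT => r_neq0.
have r_gt0 : 0 < r by rewrite lt_def r_neq0.
have cp : 0 < 1 + `|c| by have := normr_ge0 c; lra.
have ep : 0 < r / (2 * (1 + `|c|)) by rewrite divr_gt0// mulr_gt0.
have := h _ ep; rewrite ar lecR leNgt => /negP; case.
apply: le_lt_trans (_ : `|c| * (r / (2 * (1 + `|c|))) < r).
  by rewrite ler_wpM2r ?ler_norm// divr_ge0// mulr_ge0// ltW.
rewrite mulrA ltr_pdivrMr ?mulr_gt0//; have := normr_ge0 c; nra.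
Qed.

(** Scalar model of the iteration below: it increases to the smaller root of
    [t = (x + t ^ 2) / 2]. *)
Fixpoint sqrt_seq (x : R) (n : nat) : R :=
  if n is m.+1 then (x + sqrt_seq x m ^+ 2) / 2 else 0.

Lemma sqrt_seq_cvg x : 0 <= x <= 1 ->
  sqrt_seq x @ \oo --> 1 - Num.sqrt (1 - x).
Proof.
move=> /andP[x0 x1].
have t01 n : 0 <= sqrt_seq x n <= 1.
  by elim: n => [|n /andP[t0 t1]]/=; first rewrite lexx ler01//; apply/andP; split; nra.
have tS n : sqrt_seq x n <= sqrt_seq x n.+1.
  elim: n => [|n IH]/=; first by rewrite expr0n addr0; lra.
  by have /andP[? ?] := t01 n; have /andP[? ?] := t01 n.+1; rewrite /= in IH *; nra.
have tcv : cvgn (sqrt_seq x).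
  apply: nondecreasing_is_cvgn; first exact/nondecreasing_seqP.
  by exists 1 => _ [n _ <-]; case/andP: (t01 n).
set l := limn (sqrt_seq x) in tcv *.
have l1 : l <= 1.
  by apply: limr_le => //; apply: nearW => n; case/andP: (t01 n).
have eql : l = (x + l ^+ 2) / 2.
  have c1 : (fun n => sqrt_seq x n.+1) @ \oo --> l.
    by rewrite (cvg_shiftS (sqrt_seq x)).
  have c2 : (fun n => sqrt_seq x n.+1) @ \oo --> (x + l ^+ 2) / 2.
    apply: cvgMl; apply: cvgD; first exact: cvg_cst.
    exact: (cvgM tcv tcv).
  exact: (cvg_unique _ c1 c2).
suff -> : 1 - Num.sqrt (1 - x) = l by [].
have -> : 1 - x = (1 - l) ^+ 2 by move: eql; clearbody l => eql; lra.
by rewrite sqrtr_sqr ger0_norm ?subr_ge0// subKr.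
Qed.

End Domination.

Section CStar.
Variables (R : realType) (A : cstarAlgType R).
Local Notation C := R[i].
Implicit Types a b c d : A.

Lemma cmul0l a : 0 ** a = 0.
Proof. by apply: (addIr (0 ** a)); rewrite -cmulDl !add0r. Qed.

Lemma cmul0r a : a ** 0 = 0.
Proof. by apply: (addIr (a ** 0)); rewrite -cmulDr !add0r. Qed.

Lemma cmulNl a b : (- a) ** b = - (a ** b).
Proof. by apply: (addIr (a ** b)); rewrite -cmulDl !addNr cmul0l. Qed.

Lemma cmulNr a b : a ** (- b) = - (a ** b).
Proof. by apply: (addIr (a ** b)); rewrite -cmulDr !addNr cmul0r. Qed.

Lemma star0 : star 0 = 0 :> A.
Proof. by apply: (addIr (star 0)); rewrite -starD !add0r. Qed.

Lemma starN a : star (- a) = - star a.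
Proof. by apply: (addIr (star a)); rewrite -starD !addNr star0. Qed.

Lemma norm_star a : `|star a| = `|a|.
Proof.
have le_star b : `|b| <= `|star b|.
  have [->|b0] := eqVneq b 0; first by rewrite normr0.
  rewrite -(ler_pM2r (_ : 0 < `|b|)) ?normr_gt0// -expr2 -cstar_identity.
  exact: cstar_normM.
by apply: le_anti; rewrite le_star andbT -{2}(starK a) le_star.
Qed.

Lemma norm_partial_isometry a p : star a ** a = p -> star p = p -> p ** p = p ->
  `|a| <= 1.
Proof.
move=> ap sp pp; have : `|p| ^+ 2 = `|p| by rewrite -cstar_identity sp pp.
move=> /eqP; rewrite expr2 -subr_eq0 -{3}(mulr1 `|p|) -mulrBr mulf_eq0 subr_eq0.
rewrite -(@expr_le1 _ 2)// -cstar_identity ap.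
by move=> /orP[]/eqP ->.
Qed.

(** For a contraction [b], iterating [t |-> (b + t ^ 2) / 2] from [0] converges to
    [1 - sqrt (1 - b)], on the strength of norm estimates alone. *)
Fixpoint sqrt_iter b (n : nat) : A :=
  if n is m.+1 then 2^-1 *: (b + sqrt_iter b m ** sqrt_iter b m) else 0.

Lemma norm2V : `|2^-1 : C| = (2^-1 : R)%:C.
Proof. by rewrite ger0_norm ?invr_ge0// rmorphV ?unitfE//= rmorph_nat. Qed.

Lemma realC2V : (2^-1 : C) = (2^-1 : R)%:C.
Proof. by rewrite rmorphV ?unitfE//= rmorph_nat. Qed.

(** Each increment of the iteration is bounded by the corresponding increment of
    [sqrt_seq 1], because [x y - z w = (x - z) y + z (y - w)]. *)
Lemma sqrt_iter_step b : `|b| <= 1 -> forall n,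
  `|sqrt_iter b n| <= (sqrt_seq 1 n : R)%:C /\
  `|sqrt_iter b n.+1 - sqrt_iter b n|
    <= (sqrt_seq 1 n.+1 - sqrt_seq 1 n : R)%:C.
Proof.
move=> b1; have nrm n : `|sqrt_iter b n| <= (sqrt_seq 1 n : R)%:C.
  elim: n => [|n IH]; first by rewrite normr0.
  rewrite /= normrZ norm2V mulrC rmorphM/= ler_wpM2r ?ler0c//.
  apply: le_trans (ler_normD _ _) _; rewrite rmorphD/= lerD// expr2 rmorphM/=.
  by apply: le_trans (cstar_normM _ _) _; rewrite ler_pM.
move=> n; split=> //; elim: n => [|n IH].
  rewrite /= subr0 cmul0l addr0 normrZ norm2V subr0 expr0n addr0 mul1r.
  by rewrite -[leRHS]mulr1 ler_wpM2l// ler0c.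
set p := sqrt_iter b n.+1 in IH *; set q := sqrt_iter b n in IH *.
set t := sqrt_seq 1 n.+1 in IH *; set r := sqrt_seq 1 n in IH *.
have -> : sqrt_iter b n.+2 - p = 2^-1 *: ((p - q) ** p + q ** (p - q)).
  have -> : sqrt_iter b n.+2 = 2^-1 *: (b + p ** p) by [].
  have {3}-> : p = 2^-1 *: (b + q ** q) by [].
  rewrite -scalerBr opprD addrACA subrr add0r.
  by rewrite cmulDl cmulDr cmulNl cmulNr addrA addrNK.
have -> : (sqrt_seq 1 n.+2 - t : R) = 2^-1 * ((t - r) * t + r * (t - r)).
  have -> : sqrt_seq 1 n.+2 = (1 + t ^+ 2) / 2 :> R by [].
  have : t = (1 + r ^+ 2) / 2 by []. 
  by clearbody t r; lra.
rewrite normrZ norm2V rmorphM/= ler_wpM2l ?ler0c// rmorphD/=.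
apply: le_trans (ler_normD _ _) _; rewrite lerD//.
  by apply: le_trans (cstar_normM _ _) _; rewrite rmorphM/= ler_pM ?nrm.
by apply: le_trans (cstar_normM _ _) _; rewrite rmorphM/= ler_pM ?nrm.
Qed.

Lemma sqrt_iter_cvg b : `|b| <= 1 -> exists d, sqrt_iter b @ \oo --> d.
Proof.
move=> b1; apply/cvg_ex; apply: (@dominated_cvg _ A _ (@sqrt_seq R 1)).
  by move=> n; case: (sqrt_iter_step b1 n).
by apply/cvg_ex; exists (1 - Num.sqrt (1 - 1)); apply: sqrt_seq_cvg; rewrite ler01 lexx.
Qed.

Lemma cmul_cvg (u v : nat -> A) a b :
  u @ \oo --> a -> v @ \oo --> b -> (fun n => u n ** v n) @ \oo --> a ** b.
Proof.
move=> ua vb.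
have na : (fun n => `|a - u n| : C^o) @ \oo --> (0 : C^o).
  by rewrite -(normr0 A) -(subrr a); apply: cvg_norm; apply: cvgB => //; exact: cvg_cst.
have nb : (fun n => `|b - v n| : C^o) @ \oo --> (0 : C^o).
  by rewrite -(normr0 A) -(subrr b); apply: cvg_norm; apply: cvgB => //; exact: cvg_cst.
have nv : (fun n => `|v n| : C^o) @ \oo --> (`|b| : C^o) by exact: cvg_norm.
have ca : (fun=> `|a| : C^o) @ \oo --> (`|a| : C^o) by exact: cvg_cst.
have f0 : (fun n => `|a - u n| * `|v n| + `|a| * `|b - v n| : C^o) @ \oo
    --> (0 * `|b| + `|a| * 0 : C^o).
  exact: (@cvgD C C^o nat \oo _ (fun n => `|a - u n| * `|v n|)
    (fun n => `|a| * `|b - v n|) _ _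
    (@cvgM C nat \oo _ (fun n => `|a - u n|) (fun n => `|v n|) _ _ na nv)
    (@cvgM C nat \oo _ (fun=> `|a|) (fun n => `|b - v n|) _ _ ca nb)).
rewrite mul0r mulr0 addr0 in f0.
apply/cvgrPdist_le => e e0; move/cvgrPdist_le: f0 => /(_ e e0).
apply: filterS => n; rewrite sub0r normrN; apply: le_trans.
rewrite ger0_norm ?addr_ge0 ?mulr_ge0//.
have -> : a ** b - u n ** v n = (a - u n) ** v n + a ** (b - v n).
  by rewrite [RHS]addrC cmulDr cmulDl cmulNl cmulNr addrA addrNK.
apply: le_trans (ler_normD _ _) _.
by rewrite lerD// cstar_normM.
Qed.

Lemma star_cvg (u : nat -> A) a :
  u @ \oo --> a -> (fun n => star (u n)) @ \oo --> star a.
Proof.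
move=> /cvgrPdist_le ua; apply/cvgrPdist_le => e /ua.
by apply: filterS => n; rewrite -starN -starD norm_star.
Qed.

(** [1 - d] is a square root of [1 - b]. *)
Lemma sqrt_iter_lim b d : sqrt_iter b @ \oo --> d -> d + d = b + d ** d.
Proof.
move=> dl; have c1 : (fun n => sqrt_iter b n.+1) @ \oo --> d.
  by rewrite (cvg_shiftS (sqrt_iter b)).
have c2 : (fun n => sqrt_iter b n.+1) @ \oo --> 2^-1 *: (b + d ** d).
  by apply: cvgZr; apply: cvgD; [exact: cvg_cst|exact: cmul_cvg].
have e : d = 2^-1 *: (b + d ** d).
  exact: (cvg_unique (@norm_hausdorff _ A) c1 c2).
by rewrite {1 2}e -scalerDl -[2^-1]mul1r -splitr scale1r.
Qed.

Lemma sqrt_iter_star b d : star b = b -> sqrt_iter b @ \oo --> d -> star d = d.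
Proof.
move=> sb dl; have := star_cvg dl.
have -> : (fun n => star (sqrt_iter b n)) = sqrt_iter b.
  apply/funext; elim=> [|n IH]/=; first exact: star0.
  by rewrite starZ starD starM IH sb rmorphV ?unitfE//= conjC_nat.
by move=> dl'; exact: (cvg_unique (@norm_hausdorff _ A) dl' dl).
Qed.

Lemma sqrt_iter_sub (O : subCstar A) b n : O b -> O (sqrt_iter b n).
Proof.
move=> Ob; elim: n => [|n IH]; first exact: sub_0.
by apply: sub_Z; apply: sub_D => //; exact: sub_M.
Qed.

Lemma sqrt_iter_lim_sub (O : subCstar A) b d :
  O b -> sqrt_iter b @ \oo --> d -> O d.
Proof.
move=> Ob dl; apply: (closed_cvg (sub_set O)) dl; first exact: sub_closed.
by apply: nearW => n; exact: sqrt_iter_sub.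
Qed.

End CStar.

(** * Representations *)

Section Representations.
Variables (R : realType) (A : cstarAlgType R) (O : subCstar A).
Variables (H : hilbertType R) (pi : A -> {linear H -> H}).
Hypothesis rpi : representation O pi.
Local Notation C := R[i].
Implicit Types (a b d : A) (xi eta : H).

Lemma innerDl xi eta zeta :
  inner (xi + eta) zeta = inner xi zeta + inner eta zeta.
Proof. exact: linearDl. Qed.

Lemma innerBl xi eta zeta :
  inner (xi - eta) zeta = inner xi zeta - inner eta zeta.
Proof. exact: linearBl. Qed.

Lemma innerBr xi eta zeta :
  inner zeta (xi - eta) = inner zeta xi - inner zeta eta.
Proof. exact: linearBr. Qed.

Lemma innerZl (c : C) xi eta : inner (c *: xi) eta = c * inner xi eta.
Proof. exact: linearZl_LR. Qed.

Lemma innerZr (c : C) xi eta : inner eta (c *: xi) = Num.conj c * inner eta xi.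
Proof. exact: linearZr_LR. Qed.

Lemma inner0l xi : inner 0 xi = 0.
Proof. exact: linear0l. Qed.

Lemma inner0r xi : inner xi 0 = 0.
Proof. exact: linear0r. Qed.

(** For a self-adjoint [d] with [2 d - d ^ 2 = a^* a], expanding
    [0 <= |xi - pi d xi| ^ 2] gives [|pi a xi| <= |xi|]; such a [d] exists as soon
    as [a] is a contraction. *)
Lemma rep_contraction a xi : O a -> `|a| <= 1 -> `|pi a xi| <= `|xi|.
Proof.
move=> Oa a1; set b := star a ** a.
have Ob : O b by apply: sub_M => //; exact: sub_star.
have sb : star b = b by rewrite /b starM starK.
have b1 : `|b| <= 1 by rewrite /b cstar_identity expr_le1.
have [d dl] := sqrt_iter_cvg b1.
have Od := sqrt_iter_lim_sub Ob dl.
have sd := sqrt_iter_star sb dl.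
have dd := sqrt_iter_lim dl.
have bE : inner (pi b xi) xi = `|pi a xi| ^+ 2.
  rewrite -inner_norm /b (rep_M rpi)//; last exact: sub_star.
  by rewrite (rep_star rpi) ?starK//; exact: sub_star.
have dE : inner (pi d xi) xi = inner xi (pi d xi) by rewrite (rep_star rpi)// sd.
have ddE : inner (pi (d ** d) xi) xi = inner (pi d xi) (pi d xi).
  by rewrite (rep_M rpi)// [LHS](rep_star rpi)// sd.
have key : inner (xi - pi d xi) (xi - pi d xi) = `|xi| ^+ 2 - `|pi a xi| ^+ 2.
  have : inner (pi (d + d) xi) xi = inner (pi (b + d ** d) xi) xi by rewrite dd.
  rewrite !(rep_D rpi)//; last exact: sub_M.
  move=> e; rewrite !innerDl bE ddE in e.
  rewrite innerBl !innerBr -dE inner_norm; move: e.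
  set p := inner _ _; set q := inner _ _ => e.
  have -> : `|pi a xi| ^+ 2 = p + p - q by rewrite e addrK.
  by ring.
rewrite -(@ler_pXn2r _ 2)// ?nnegrE//.
by rewrite -subr_ge0 -key inner_norm exprn_ge0.
Qed.

Lemma rep_norm a xi : O a -> `|pi a xi| <= `|a| * `|xi|.
Proof.
move=> Oa; have [->|a0] := eqVneq a 0.
  rewrite normr0 mul0r -(scale0r (0 : A)) (rep_Z rpi) ?scale0r ?normr0//.
  exact: sub_0.
have na0 : `|a| != 0 by rewrite normr_eq0.
rewrite -[a in pi a](scalerKV na0) (rep_Z rpi); last exact: sub_Z.
rewrite normrZ normr_id ler_wpM2l// rep_contraction//; first exact: sub_Z.
by rewrite normrZ normfV normr_id mulVf.
Qed.

(** Elements acting as scalars on the range of one projection form an algebra;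
    computing the scalars takes the place of functional calculus. *)
Definition acts_by q a (x : C) := forall xi, pi a xi = x *: pi q xi.

Section ActsBy.
Variable q : A.
Hypotheses (Oq : O q) (qq : q ** q = q).

Lemma acts_by_id : acts_by q q 1.
Proof. by move=> xi; rewrite scale1r. Qed.

Lemma acts_byD a b x y : O a -> O b ->
  acts_by q a x -> acts_by q b y -> acts_by q (a + b) (x + y).
Proof. by move=> Oa Ob ax bY xi; rewrite (rep_D rpi)// ax bY scalerDl. Qed.

Lemma acts_byZ a x (c : C) : O a -> acts_by q a x -> acts_by q (c *: a) (c * x).
Proof. by move=> Oa ax xi; rewrite (rep_Z rpi)// ax scalerA. Qed.

Lemma acts_byM a b x y : O a -> O b ->
  acts_by q a x -> acts_by q b y -> acts_by q (a ** b) (x * y).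
Proof.
move=> Oa Ob ax bY xi; rewrite (rep_M rpi)// ax bY linearZ/= -(rep_M rpi)// qq.
by rewrite scalerA.
Qed.

Lemma acts_by0 : acts_by q 0 0.
Proof.
move=> xi; rewrite scale0r -(scale0r (0 : A)) (rep_Z rpi) ?scale0r//.
exact: sub_0.
Qed.

Lemma acts_by_sqrt_iter b (x : R) n :
  O b -> acts_by q b x%:C -> acts_by q (sqrt_iter b n) (sqrt_seq x n)%:C.
Proof.
move=> Ob bx; elim: n => [|n IH]; first exact: acts_by0.
rewrite /= mulrC rmorphM/= -realC2V rmorphD/= expr2 rmorphM/=.
have On := sqrt_iter_sub n Ob; have Onn := sub_M On On.
apply: acts_byZ; first exact: sub_D.
by apply: acts_byD => //; exact: acts_byM.
Qed.

(** The iteration converges in norm, so, [pi] being contractive, its value on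
    the range of [pi q] is the limit of the scalar iteration. *)
Lemma acts_by_sqrt b d (x : R) : O b -> 0 <= x <= 1 -> acts_by q b x%:C ->
  sqrt_iter b @ \oo --> d -> acts_by q (q - d) (Num.sqrt (1 - x))%:C.
Proof.
move=> Ob x01 bx dl xi; have Od := sqrt_iter_lim_sub Ob dl.
have cxi : (fun n => pi (sqrt_iter b n) xi) @ \oo --> pi d xi.
  apply/cvgrPdist_le => e e0.
  have e'0 : 0 < e / (1 + `|xi|) by rewrite divr_gt0// ltr_wpDr.
  move/cvgrPdist_le: dl => /(_ _ e'0); apply: filterS => n dn.
  have On := sqrt_iter_sub n Ob; have ON : O (- sqrt_iter b n).
    by rewrite -scaleN1r; exact: sub_Z.
  have -> : pi d xi - pi (sqrt_iter b n) xi = pi (d - sqrt_iter b n) xi.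
    by rewrite (rep_D rpi)// -[- sqrt_iter b n]scaleN1r (rep_Z rpi)// scaleN1r.
  apply: le_trans (rep_norm _ _) _; first exact: sub_D.
  apply: le_trans (ler_wpM2r (normr_ge0 _) dn) _.
  rewrite mulrAC ler_pdivrMr ?ltr_wpDr// ler_wpM2l ?ltW//.
  by rewrite ltrDr ltr01.
have cs : (fun n => pi (sqrt_iter b n) xi) @ \oo
    --> (1 - Num.sqrt (1 - x))%:C *: pi q xi.
  have -> : (fun n => pi (sqrt_iter b n) xi)
      = (fun n => (sqrt_seq x n)%:C *: pi q xi).
    by apply/funext => n; exact: acts_by_sqrt_iter.
  apply: cvgZl; apply: (cvg_comp _ _ (sqrt_seq_cvg x01)).
  exact: real_complex_continuous.
have dE := cvg_unique (@norm_hausdorff _ H) cxi cs.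
have ON : O (- d) by rewrite -scaleN1r; exact: sub_Z.
rewrite (rep_D rpi)// -[- d]scaleN1r (rep_Z rpi)// scaleN1r dE.
by rewrite rmorphB scalerBl/= scale1r subKr.
Qed.

End ActsBy.

End Representations.

(** * Orthonormal bases *)

Section HilbertBasis.
Variables (R : realType) (H : hilbertType R).
Local Notation C := R[i].
Implicit Types xi eta : H.

Lemma innerC xi eta : inner xi eta = Num.conj (inner eta xi).
Proof. by rewrite hermC expr0 mul1r. Qed.

Lemma inner_eq0 xi : inner xi xi = 0 -> xi = 0.
Proof. by rewrite inner_norm => /eqP; rewrite expf_eq0/= normr_eq0 => /eqP. Qed.

Lemma inner_ext xi eta : (forall zeta, inner xi zeta = inner eta zeta) -> xi = eta.
Proof.
move=> h; apply/eqP; rewrite -subr_eq0; apply/eqP/inner_eq0.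
by rewrite innerBl h subrr.
Qed.

Lemma inner_bound xi eta : inner eta eta = 1 -> `|inner xi eta| <= `|xi|.
Proof.
move=> e1; set c := inner xi eta.
have : 0 <= inner (xi - c *: eta) (xi - c *: eta) by rewrite inner_norm exprn_ge0.
rewrite innerBl !innerBr !innerZl !innerZr e1 -/c (innerC eta xi) -/c mulr1.
rewrite [Num.conj c * c]mulrC subrr subr0 inner_norm -normCK subr_ge0.
by rewrite ler_pXn2r ?nnegrE.
Qed.

Lemma inner_suml n (c : 'I_n -> C) (e : 'I_n -> H) zeta :
  inner (\sum_i c i *: e i) zeta = \sum_i c i * inner (e i) zeta.
Proof.
elim/big_ind2: _ => [|a b a' b' <- <-|i _]; first exact: inner0l.
  exact: innerDl.
exact: innerZl.
Qed.

Section Basis.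
Variables (I : Type) (X : set I) (delta : I -> H).
Hypothesis l2 : is_l2 X delta.

(** An approximation of [zeta] by combinations of basis vectors is orthogonal
    to [zeta], so by Pythagoras its error is at least the norm of [zeta]. *)
Lemma basis_eq0 zeta : (forall w, X w -> inner (delta w) zeta = 0) -> zeta = 0.
Proof.
move=> h; apply: (@eq0_small R H _ 1) => e e0; rewrite mul1r.
case: l2 => _ _ dense.
have : closure (lspan (delta @` X)) zeta by rewrite dense.
move=> /(_ (ball zeta e%:C))[|eta [[n [c [f [fX ->]]]] hb]].
  by apply: nbhsx_ballx; rewrite ltcR.
set eta' := \sum_(i < n) _ in hb.
have ortho : inner eta' zeta = 0.
  rewrite inner_suml big1// => i _.
  by have [w Xw <-] := fX i; rewrite h// mulr0.
move: hb; rewrite -ball_normE /ball_/= => /ltW; apply: le_trans.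
rewrite -(@ler_pXn2r _ 2)// ?nnegrE// -!inner_norm.
rewrite innerBl !innerBr ortho (innerC zeta eta') ortho conjC0 subr0 sub0r opprK.
by rewrite !inner_norm lerDl exprn_ge0.
Qed.

Lemma basis_linear_eq (f g : {linear H -> H}) : continuous f -> continuous g ->
  (forall w, X w -> f (delta w) = g (delta w)) -> f =1 g.
Proof.
move=> cf cg fg xi; apply/eqP; rewrite -subr_eq0; apply/eqP.
have cl : closed [set xi : H | f xi - g xi = 0].
  apply: (@closed_comp _ _ (fun xi => f xi - g xi) [set 0]).
    by move=> eta _; apply: cvgB; [exact: cf|exact: cg].
  exact: accessible_closed_set1 (hausdorff_accessible (@norm_hausdorff _ H)) _.
case: l2 => _ _ dense.
suff : closure (lspan (delta @` X)) `<=` [set xi : H | f xi - g xi = 0].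
  by apply; rewrite dense.
rewrite closureE => eta; apply; split=> // _ [n [c [e [eX ->]]]] /=.
rewrite [f _]linear_sum [g _]linear_sum -sumrB big1// => i _.
rewrite [f _]linearZ [g _]linearZ/=.
by have [w Xw <-] := eX i; rewrite fg// subrr.
Qed.

End Basis.

End HilbertBasis.

(** * The representations on orbits of infinite paths *)

Section CharacterValues.
Variables (R : realType) (k : nat) (F : dual R [set: lattice k]).
Implicit Types a b : lattice k.

Lemma charT_norm a : `|dual_appT F a| = 1.
Proof. exact: (dualP F).1. Qed.

Lemma charTD a b : dual_appT F (a + b) = dual_appT F a * dual_appT F b.
Proof. exact: (dualP F).2. Qed.

Lemma charT_conj a : dual_appT F a * Num.conj (dual_appT F a) = 1.
Proof. by rewrite -normCK charT_norm expr1n. Qed.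

Lemma charTB a b :
  dual_appT F (a - b) = dual_appT F a * Num.conj (dual_appT F b).
Proof.
by rewrite -[in RHS](subrK b a) [in RHS]charTD -mulrA charT_conj mulr1.
Qed.

End CharacterValues.

Lemma trig_continuous (R : realType) (k n : nat) (b : 'I_n -> R[i])
    (d : 'I_n -> set_type [set: lattice k]) :
  continuous ((fun F => \sum_i b i * F (d i))
    : {ptws set_type [set: lattice k] -> R[i]^o} -> R[i]^o).
Proof.
apply: (@continuous_big R[i]^o _ +%R 0 predT); first exact: add_continuous.
move=> i _ F.
exact: (@cvgM R[i] _ (nbhs F) _ (fun=> b i) (fun F => F (d i)) _ _ (cvg_cst _)
  (@ptws_eval R k _ (d i) F)).
Qed.

Section Generators.
Variables (R : realType) (G : groupType) (k : nat) (L : kGraph k).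
Variables (S : selfSimilar G L) (FV : condFV S) (A : cstarAlgType R).
Variables (u : G -> A) (s : L -> A) (us : family S u s).
Variables (O : subCstar A) (O_def : sub_set O = OGL S u s).
Local Notation C := R[i].

Lemma u1 : u 1%g = cone.
Proof.
have [uu _] := fam_unitary us 1%g.
by rewrite -uu -{3}(mulg1 1%g) (fam_unitaryM us) cmulA uu cmul1l.
Qed.

Lemma gen_in m g n : sc m = act S g (sc n) -> O (s m ** u g ** star (s n)).
Proof.
move=> mn; rewrite O_def; apply: subset_closure.
exists 1%N, (fun=> 1), (fun=> s m ** u g ** star (s n)).
by rewrite big_ord1 scale1r; split=> // _; exists m, g, n.
Qed.

Lemma gen1E m n : s m ** star (s n) = s m ** u 1%g ** star (s n).
Proof. by rewrite u1 cmul1r. Qed.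

Lemma gen1_in m n : sc m = sc n -> O (s m ** star (s n)).
Proof. by move=> mn; rewrite gen1E; apply: gen_in; rewrite act_1. Qed.

Lemma s_norm m : `|s m| <= 1.
Proof.
have [ss pp] := fam_projection us (deg_sc m : vertices (sc m)).
exact: (norm_partial_isometry (fam_source us m) ss pp).
Qed.

Lemma gen1_norm m n : `|s m ** star (s n)| <= 1.
Proof.
apply: le_trans (cstar_normM _ _) _; rewrite norm_star.
by rewrite mulr_ile1// s_norm.
Qed.

Lemma gen1_star m n : star (s m ** star (s n)) = s n ** star (s m).
Proof. by rewrite starM starK. Qed.

Lemma range_idem n : s n ** star (s n) ** (s n ** star (s n)) = s n ** star (s n).
Proof. by rewrite cmulA (fam_partial_isometry us). Qed.

Section PiFx.
Variables (F : dual R [set: lattice k]) (x : omega k -> L).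
Variables (H : hilbertType R) (delta : (omega k -> L) -> H) (pi : A -> {linear H -> H}).
Hypotheses (ix : infinite_path setT x) (is_piF : is_pi S u s O F x delta pi).
Implicit Types y z w : omega k -> L.

Let l2 : is_l2 (orbit_class S x) delta.
Proof. by case: is_piF. Qed.

Lemma pi_rep : representation O pi.
Proof. by case: is_piF. Qed.

Lemma basis_neq0 y : orbit_class S x y -> delta y <> 0.
Proof.
case: l2 => d1 _ _ /d1 + dy0; rewrite dy0 inner0l => /eqP.
by rewrite eq_sym oner_eq0.
Qed.

Lemma inner_basis y z : orbit_class S x y -> orbit_class S x z ->
  inner (delta y) (delta z) = (`[< y = z >])%:R.
Proof.
case: l2 => d1 d0 _ xy xz; case: asboolP => [<-|yz]; first exact: d1.
exact: d0.
Qed.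

(** Pairing with [delta w] turns [S_n^*] into [S_n], which maps [delta w] to a
    multiple of [delta (n w)]; this is [delta y] only when [y = n w]. *)
Lemma adjoint_basis (Vn Vsn : {linear H -> H}) n y :
  (forall xi eta, inner (Vn xi) eta = inner xi (Vsn eta)) ->
  (forall w, orbit_class S x w -> sc n <> origin w -> Vn (delta w) = 0) ->
  (forall w z, orbit_class S x w -> infinite_path setT z -> is_concat n w z ->
    Vn (delta w) = dual_appT F (degZ (deg n)) *: delta z) ->
  orbit_class S x y ->
  Vsn (delta y) = if `[< initial y (deg n) = n >]
    then Num.conj (dual_appT F (degZ (deg n))) *: delta (path_shift (deg n) y)
    else 0.
Proof.
move=> adj V0 Vc xy; apply/eqP; rewrite -subr_eq0; apply/eqP.
apply: (basis_eq0 l2) => w xw; rewrite innerBr -adj; apply/eqP; rewrite subr_eq0.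
apply/eqP; have iy := orbit_path xy; have iw := orbit_path xw.
case: asboolP => [yn|yn].
  have cny : is_concat n (path_shift (deg n) y) y by [].
  have xy' := orbit_uncat ix (shift_path (deg n) iy) cny xy.
  rewrite innerZr conjCK inner_basis//.
  have [nw|nw] := pselect (sc n = origin w); last first.
    rewrite V0// inner0l; case: asboolP => [wE|_]; last by rewrite mulr0.
    by case: nw; rewrite wE (concat_sc iy cny).
  have [z iz nz] := concat_exists iw nw.
  rewrite (Vc _ _ xw iz nz) innerZl inner_basis//; last exact: orbit_concat nz xw.
  congr (_ * _%:R); congr nat_of_bool; apply/asbool_equiv_eq; split=> [zy|wE].
    by rewrite -zy; case: nz.
  by rewrite wE in nz; exact: concat_unique nz cny.
rewrite inner0r; have [nw|nw] := pselect (sc n = origin w); last first.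
  by rewrite V0// inner0l.
have [z iz nz] := concat_exists iw nw.
rewrite (Vc _ _ xw iz nz) innerZl inner_basis//; last exact: orbit_concat nz xw.
case: asboolP => [zy|]; last by rewrite mulr0.
by case: yn; rewrite -zy; case: nz.
Qed.

Lemma pi_gen m g n y : sc m = act S g (sc n) -> orbit_class S x y ->
  (initial y (deg n) <> n -> pi (s m ** u g ** star (s n)) (delta y) = 0) /\
  (initial y (deg n) = n -> forall z, infinite_path setT z ->
    is_concat m (path_act S g (path_shift (deg n) y)) z ->
    pi (s m ** u g ** star (s n)) (delta y) =
    dual_appT F (degZ (deg m) - degZ (deg n)) *: delta z).
Proof.
case: is_piF => _ _ [V [Vs [W [VVs _ WE VE piE]]]] mn xy.
have iy := orbit_path xy.
have [_ _ adj] := VVs n; have VsE := @adjoint_basis (V n) (Vs n) n y adj.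
rewrite (piE _ _ _ mn) VsE//; first last.
- by move=> w z xw iz; exact: (VE n w xw).2.
- by move=> w xw; exact: (VE n w xw).1.
split=> [yn|yn z iz mz]; first by case: asboolP => // _; rewrite !linear0.
case: asboolP => // _.
have cny : is_concat n (path_shift (deg n) y) y by [].
have xy' := orbit_uncat ix (shift_path (deg n) iy) cny xy.
rewrite !linearZ/= WE// ((VE m _ (orbit_act FV g xy')).2 _ iz mz).
by rewrite scalerA charTB mulrC.
Qed.

(** If [y = n y'], then also [y = m y'], because [(m, n)] is a cycline pair;
    so both operators keep [delta y] up to a scalar. *)
Lemma pi_cycline m n xi : cycline_pair S setT m n ->
  pi (s m ** star (s n)) xi =
  dual_appT F (degZ (deg m) - degZ (deg n)) *: pi (s n ** star (s n)) xi.
Proof.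
move=> /cycline_pairP[_ _ mn h].
have On : O (s n ** star (s n)) by exact: gen1_in.
set c := dual_appT F _; rewrite -(rep_Z pi_rep)//; move: xi.
apply: (basis_linear_eq l2); try apply: (rep_continuous pi_rep).
- exact: gen1_in.
- exact: sub_Z.
move=> y xy; rewrite (rep_Z pi_rep)// !gen1E; have iy := orbit_path xy.
have mn' : sc m = act S 1%g (sc n) by rewrite act_1.
have nn' : sc n = act S 1%g (sc n) by rewrite act_1.
have [m0 mE] := pi_gen mn' xy; have [n0 nE] := pi_gen nn' xy.
have [yn|yn] := pselect (initial y (deg n) = n); last first.
  by rewrite m0// n0// scaler0.
have cny : is_concat n (path_shift (deg n) y) y by [].
have [z [iz mz nz]] := h _ (shift_path (deg n) iy) (esym (concat_sc iy cny)).
rewrite (mE yn z) ?path_act1// (nE yn z) ?path_act1//.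
have -> : dual_appT F (degZ (deg n) - degZ (deg n)) = 1.
  by rewrite charTB charT_conj.
by rewrite scale1r.
Qed.

Lemma range_basis n y : orbit_class S x y -> initial y (deg n) = n ->
  pi (s n ** star (s n)) (delta y) = delta y.
Proof.
move=> xy yn; rewrite gen1E; have nn' : sc n = act S 1%g (sc n) by rewrite act_1.
rewrite ((pi_gen nn' xy).2 yn y (orbit_path xy)) ?path_act1//.
by rewrite charTB charT_conj scale1r.
Qed.

Lemma acts_by_cycline m n : cycline_pair S setT m n ->
  acts_by pi (s n ** star (s n)) (s m ** star (s n))
    (dual_appT F (degZ (deg m) - degZ (deg n))).
Proof. by move=> mn xi; exact: pi_cycline. Qed.

Lemma acts_by_cycline_star m n : cycline_pair S setT m n ->
  acts_by pi (s n ** star (s n)) (s n ** star (s m))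
    (Num.conj (dual_appT F (degZ (deg m) - degZ (deg n)))).
Proof.
move=> mn xi; have mn' : sc m = sc n by case/cycline_pairP: mn.
apply: inner_ext => eta; rewrite -(gen1_star m n).
rewrite (rep_star pi_rep) ?gen1_star//; last exact: gen1_in.
rewrite pi_cycline// innerZr innerZl; congr (_ * _).
by rewrite [RHS](rep_star pi_rep) ?gen1_star//; exact: gen1_in.
Qed.

Lemma pi_sum n (c : 'I_n -> C) (e : 'I_n -> A) xi : (forall i, O (e i)) ->
  O (\sum_i c i *: e i) /\
  pi (\sum_i c i *: e i) xi = \sum_i c i *: pi (e i) xi.
Proof.
move=> Oe; elim/big_ind2: _ => [|a a' b b' [Oa <-] [Ob <-]|i _].
- split; first exact: sub_0.
  rewrite -(scale0r (0 : A)) (rep_Z pi_rep) ?scale0r//; exact: sub_0.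
- by split; [exact: sub_D|rewrite (rep_D pi_rep)].
- by split; [exact: sub_Z|rewrite (rep_Z pi_rep)].
Qed.

Lemma pi_basis_norm a y : O a -> orbit_class S x y -> `|pi a (delta y)| <= `|a|.
Proof.
move=> Oa xy; have /eqP := inner_norm (delta y).
rewrite inner_basis//; case: asboolP => // _; rewrite eq_sym sqrf_eq1 => /orP[]/eqP dy.
  by rewrite -[leRHS]mulr1 -dy; exact: (rep_norm pi_rep).
by have := normr_ge0 (delta y); rewrite dy oppr_ge0 ler10.
Qed.

End PiFx.

(** The matrix coefficients of a generator in [pi_(F, x)] depend on [F] through a
    single value of [F]; the other factor is decided by the paths alone. *)
Lemma gen_coefficient x m g n y z :
  infinite_path setT x -> sc m = act S g (sc n) ->
  orbit_class S x y -> orbit_class S x z ->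
  exists c : C, forall F (H : hilbertType R) delta (pi : A -> {linear H -> H}),
    is_pi S u s O F x delta pi ->
    inner (pi (s m ** u g ** star (s n)) (delta y)) (delta z) =
    c * dual_appT F (degZ (deg m) - degZ (deg n)).
Proof.
move=> ix mn xy xz; have iy := orbit_path xy.
have [yn|yn] := pselect (initial y (deg n) = n); last first.
  exists 0 => F H delta pi piF.
  by rewrite ((pi_gen ix piF mn xy).1 yn) inner0l mul0r.
have cny : is_concat n (path_shift (deg n) y) y by [].
have xy' := orbit_act FV g (orbit_uncat ix (shift_path (deg n) iy) cny xy).
have [|w iw mw] := concat_exists (m := m) (orbit_path xy').
  by rewrite mn (concat_sc iy cny) !originE initial_act//; exact: shift_path.
exists (`[< w = z >])%:R => F H delta pi piF.
rewrite ((pi_gen ix piF mn xy).2 yn w iw mw) innerZl (inner_basis piF)//.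
  by rewrite mulrC.
exact: orbit_concat mw xy'.
Qed.

Lemma gen_combination x y z n (c : 'I_n -> C) (e : 'I_n -> A) :
  infinite_path setT x -> orbit_class S x y -> orbit_class S x z ->
  (forall i, exists m g n, sc m = act S g (sc n) /\
     e i = s m ** u g ** star (s n)) ->
  exists (b : 'I_n -> C) (d : 'I_n -> lattice k),
  forall F (H : hilbertType R) delta (pi : A -> {linear H -> H}),
    is_pi S u s O F x delta pi ->
    inner (pi (\sum_i c i *: e i) (delta y)) (delta z) =
    \sum_i b i * dual_appT F (d i).
Proof.
move=> ix xy xz egen.
have coef i : exists bd : C * lattice k,
    forall F (H : hilbertType R) delta (pi : A -> {linear H -> H}),
    is_pi S u s O F x delta pi ->
    inner (pi (e i) (delta y)) (delta z) = bd.1 * dual_appT F bd.2.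
  have [m [g [l [ml ->]]]] := egen i.
  have [b bP] := gen_coefficient ix ml xy xz.
  by exists (b, degZ (deg m) - degZ (deg l)).
have [bd bdP] := choice coef.
exists (fun i => c i * (bd i).1), (fun i => (bd i).2) => F H delta pi piF.
have Oe i : O (e i) by have [m [g [l [ml ->]]]] := egen i; exact: gen_in.
rewrite (pi_sum piF c (delta y) Oe).2 inner_suml; apply: eq_bigr => i _.
by rewrite (bdP i _ _ _ _ piF) mulrA.
Qed.

(** A matrix coefficient of [pi_(F, x) a] is a limit of trigonometric polynomials
    in [F], uniformly in [F] because representations are contractive. *)
Lemma kernel_closed x (K : dual R [set: lattice k] -> set A) a :
  infinite_path setT x -> O a ->
  (forall F, exists (H : hilbertType R) delta (pi : A -> {linear H -> H}),
     is_pi S u s O F x delta pi /\ K F = rep_ker O pi) ->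
  closed [set F : {ptws set_type [set: lattice k] -> C^o} |
    exists2 F', set_val F' = F & K F' a].
Proof.
move=> ix Oa KP F0 clF0.
have ch0 : is_character F0.
  apply: is_character_closed; apply: closure_subset clF0.
  by move=> _ [F <- _]; exact: dualP.
exists (mk_dual ch0) => //.
have [H0 [delta0 [pi0 [piF0 ->]]]] := KP (mk_dual ch0).
have rpi0 := pi_rep piF0; case: (piF0) => l20 _ _.
split=> // xi; rewrite -[RHS](scale0r (pi0 a xi)) -(rep_Z rpi0)//; move: xi.
apply: (basis_linear_eq l20); try apply: (rep_continuous rpi0) => //.
  exact: sub_Z.
move=> y xy; rewrite [RHS](rep_Z rpi0)// scale0r.
apply: (basis_eq0 l20) => z xz; rewrite innerC.
suff -> : inner (pi0 a (delta0 y)) (delta0 z) = 0 by rewrite conjC0.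
apply: (@eq0_small R C^o _ 3) => e e0.
have eC0 : 0 < e%:C :> C by rewrite ltcR.
have : closure (lspan [set b | exists m g n,
    sc m = act S g (sc n) /\ b = s m ** u g ** star (s n)]) a.
  by have : sub_set O a by []; rewrite O_def.
move=> /(_ (ball a e%:C))[|_ [[n [c [f [fX ->]]]] hb]].
  exact: nbhsx_ballx.
rewrite -ball_normE /ball_/= in hb.
have Of i : O (f i) by have [m [g [l [ml ->]]]] := fX i; exact: gen_in.
have [b [d bdP]] := gen_combination c ix xy xz fX.
set w := \sum_i _ in hb bdP.
have Ow : O w by exact: (pi_sum piF0 c 0 Of).1.
pose phi (F : {ptws set_type [set: lattice k] -> C^o}) : C^o :=
  \sum_i b i * F (exist _ (d i) (in_setT (d i))).
have phi_cont : continuous phi by exact: trig_continuous.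
have close F (H : hilbertType R) delta (pi : A -> {linear H -> H}) :
    is_pi S u s O F x delta pi ->
    `|inner (pi a (delta y)) (delta z) - phi (set_val F)| <= e%:C.
  move=> piF; have rpi := pi_rep piF; rewrite [phi _](_ : _ = inner (pi w (delta y)) (delta z)).
    rewrite -innerBl (_ : _ - _ = pi (a - w) (delta y)); last first.
      have ON : O (- w) by rewrite -scaleN1r; exact: sub_Z.
      by rewrite (rep_D rpi)// -[- w]scaleN1r (rep_Z rpi)// scaleN1r.
    apply: le_trans (inner_bound _ _) _.
      by rewrite (inner_basis piF)//; case: asboolP.
    apply: le_trans (ltW hb); apply: (pi_basis_norm piF) => //.
    by apply: sub_D => //; rewrite -scaleN1r; exact: sub_Z.
  by rewrite (bdP _ _ _ _ piF).
move/cvgrPdist_lt: (phi_cont F0) => /(_ _ eC0)/clF0[_ [[F <- KFa]]].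
rewrite /= => phiF.
have [H [delta [pi [piF KE]]]] := KP F; rewrite KE in KFa.
have := close _ _ _ _ piF; rewrite (KFa.2 (delta y)) inner0l sub0r normrN => phiF'.
have := close _ _ _ _ piF0; rewrite [set_val _]/= => h0.
have -> : inner (pi0 a (delta0 y)) (delta0 z) =
    (inner (pi0 a (delta0 y)) (delta0 z) - phi F0)
    + ((phi F0 - phi (set_val F)) + phi (set_val F)).
  by rewrite !subrK.
have -> : (3 * e)%:C = e%:C + (e%:C + e%:C) :> C.
  by rewrite -!rmorphD/=; congr (_%:C); lra.
apply: le_trans (ler_normD _ _) _; rewrite lerD//.
by apply: le_trans (ler_normD _ _) _; rewrite lerD// ltW.
Qed.


Lemma unit_dot (p q g h : R) : p ^+ 2 + q ^+ 2 = 1 -> g ^+ 2 + h ^+ 2 = 1 ->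
  0 <= (1 + (p * g + q * h)) / 2 <= 1.
Proof.
move=> pq gh; have := sqr_ge0 (p - g); have := sqr_ge0 (q - h).
have := sqr_ge0 (p + g); have := sqr_ge0 (q + h).
by move=> *; apply/andP; split; nra.
Qed.

Lemma chord_value (p q g h : R) :
  4^-1 * (2 + Num.conj (g +i* h) * (p +i* q) + (g +i* h) * Num.conj (p +i* q))
  = ((1 + (p * g + q * h)) / 2)%:C :> C.
Proof.
have -> : 4^-1 = (4^-1 : R)%:C :> C by rewrite rmorphV ?unitfE//= rmorph_nat.
have -> : 2 = (2 : R)%:C :> C by rewrite rmorph_nat.
by apply/eqP; rewrite eq_complex/=; apply/andP; split; apply/eqP; field.
Qed.

(** Let [Q = s_n s_n^*] and [V = s_m s_n^*]. For [|v| = |c| = 1], the half chord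
    [|v - c| / 2] is the square root of [1 - |v + c| ^ 2 / 4], and [|v + c| ^ 2 / 4]
    is the value of a combination of [Q], [V] and [V^*] whose coefficients have
    absolute sum [1]. This combination is therefore a contraction, to which the
    square root iteration applies. *)
Lemma half_chord_element m n (w0 c : C) : sc m = sc n ->
  `|w0| = 1 -> `|c| = 1 ->
  exists a, O a /\ forall (H : hilbertType R) (pi : A -> {linear H -> H}) (v : C)
      (x : R), representation O pi ->
    acts_by pi (s n ** star (s n)) (s m ** star (s n)) (v * w0) ->
    acts_by pi (s n ** star (s n)) (s n ** star (s m)) (Num.conj (v * w0)) ->
    4^-1 * (2 + Num.conj c * v + c * Num.conj v) = x%:C -> 0 <= x <= 1 ->
    acts_by pi (s n ** star (s n)) a (Num.sqrt (1 - x))%:C.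
Proof.
move=> mn w01 c1; set Q := s n ** star (s n).
set V := s m ** star (s n); set V' := s n ** star (s m).
have OQ : O Q by exact: gen1_in.
have OV : O V by exact: gen1_in.
have OV' : O V' by exact: gen1_in.
have w0w0 : w0 * Num.conj w0 = 1 by rewrite -normCK w01 expr1n.
set X := 4^-1 *: (2 *: Q + (Num.conj c * Num.conj w0) *: V + (c * w0) *: V').
have X1 : `|X| <= 1.
  rewrite normrZ gtr0_norm ?invr_gt0// mulrC ler_pdivrMr// mul1r.
  have -> : 4 = 2 + 1 + 1 :> C by ring.
  apply: le_trans (ler_normD _ _) _; rewrite lerD//; last first.
    by rewrite normrZ normrM c1 w01 !mul1r gen1_norm.
  apply: le_trans (ler_normD _ _) _; rewrite lerD//; last first.
    by rewrite normrZ normrM !norm_conjC c1 w01 !mul1r gen1_norm.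
  by rewrite normrZ ger0_norm// ler_piMr// gen1_norm.
have O1 : O (2 *: Q + (Num.conj c * Num.conj w0) *: V).
  by apply: sub_D; exact: sub_Z.
have OX : O X by apply: sub_Z; apply: sub_D => //; exact: sub_Z.
have [d dl] := sqrt_iter_cvg X1; have Od := sqrt_iter_lim_sub OX dl.
exists (Q - d); split.
  by apply: sub_D => //; rewrite -scaleN1r; exact: sub_Z.
move=> H pi v x rpi VE V'E xE x01.
apply: (acts_by_sqrt rpi OQ (range_idem n) OX x01 _ dl).
rewrite -xE; apply: (acts_byZ rpi); first by apply: sub_D => //; exact: sub_Z.
apply: (acts_byD rpi) => //; first exact: sub_Z; last first.
  rewrite (_ : c * Num.conj v = (c * w0) * Num.conj (v * w0)).
    exact: (acts_byZ rpi).
  by rewrite rmorphM/= -[RHS]mulrA [w0 * _]mulrCA w0w0 mulr1.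
apply: (acts_byD rpi); try exact: sub_Z.
  by rewrite -[X in acts_by _ _ _ X]mulr1; apply: (acts_byZ rpi) => //; exact: acts_by_id.
rewrite (_ : Num.conj c * v = (Num.conj c * Num.conj w0) * (v * w0)).
  exact: (acts_byZ rpi).
by rewrite -[RHS]mulrA [_ * (v * w0)]mulrC -[v * w0 * _]mulrA w0w0 mulr1.
Qed.

(** On the unit circle [|v - c| |v - c^*| = 2 |Re v - Re c|], so two half chords
    produce the positive part of [Re v - Re c], which vanishes off an arc. *)
Lemma arc_element m n (w0 : C) (g : R) : cycline_pair S setT m n ->
  `|w0| = 1 -> -1 <= g <= 1 ->
  exists a, O a /\ forall F x (H : hilbertType R) delta (pi : A -> {linear H -> H}),
    infinite_path setT x -> is_pi S u s O F x delta pi ->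
    acts_by pi (s n ** star (s n)) a
     (let p := complex.Re (dual_appT F (degZ (deg m) - degZ (deg n)) * Num.conj w0)
      in p - g + `|p - g|)%:C.
Proof.
move=> cmn w01 /andP[g_ge g_le].
have mn : sc m = sc n by case/cycline_pairP: cmn.
have w0w0 : w0 * Num.conj w0 = 1 by rewrite -normCK w01 expr1n.
pose h := Num.sqrt (1 - g ^+ 2).
have gh : g ^+ 2 + h ^+ 2 = 1.
  by rewrite sqr_sqrtr; [rewrite addrC subrK|nra].
have c1 : `|g +i* h| = 1 by rewrite normc_def/= gh sqrtr1.
have c1' : `|g -i* h| = 1 by rewrite normc_def/= sqrrN gh sqrtr1.
have [b1 [Ob1 b1P]] := half_chord_element mn w01 c1.
have [b2 [Ob2 b2P]] := half_chord_element mn w01 c1'.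
set Q := s n ** star (s n); set V := s m ** star (s n); set V' := s n ** star (s m).
have OQ : O Q by exact: gen1_in.
have OV : O V by exact: gen1_in.
have OV' : O V' by exact: gen1_in.
have Ob : O (b1 ** b2) by exact: sub_M.
exists (2^-1 *: (Num.conj w0 *: V + w0 *: V') + (- g%:C) *: Q + 2 *: (b1 ** b2)).
have O1 : O (Num.conj w0 *: V + w0 *: V') by apply: sub_D; exact: sub_Z.
have O2 : O (2^-1 *: (Num.conj w0 *: V + w0 *: V') + (- g%:C) *: Q).
  by apply: sub_D; exact: sub_Z.
split; first by apply: sub_D => //; exact: sub_Z.
move=> F x H delta pi ix piF /=; have rpi := pi_rep piF.
set z := dual_appT F _.
have VE : acts_by pi Q V z by exact: (acts_by_cycline ix piF).
have V'E : acts_by pi Q V' (Num.conj z) by exact: (acts_by_cycline_star ix piF).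
pose v := z * Num.conj w0.
have zE : z = v * w0 by rewrite /v -mulrA [_ * w0]mulrC w0w0 mulr1.
have v1 : `|v| = 1 by rewrite normrM charT_norm norm_conjC w01 mul1r.
rewrite -/v; have : v = complex.Re v +i* complex.Im v by case: (v).
set p := complex.Re v; set q := complex.Im v => vE.
have pq : p ^+ 2 + q ^+ 2 = 1.
  have := congr1 (fun r => complex.Re (r ^+ 2)) v1.
  by rewrite -add_Re2_Im2 expr1n.
have val1 := chord_value p q g h; have val2 := chord_value p q g (- h).
rewrite -vE in val1 val2; rewrite mulrN in val2.
have b1E := b1P H pi v _ rpi; rewrite -zE in b1E.
have {}b1E := b1E _ VE V'E val1.
have b2E := b2P H pi v _ rpi; rewrite -zE in b2E.
have {}b2E := b2E _ VE V'E val2.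
have x1 := unit_dot pq gh; have x2 : 0 <= (1 + (p * g - q * h)) / 2 <= 1.
  by rewrite -mulrN unit_dot// sqrrN.
have b12 : acts_by pi Q (b1 ** b2) (`|p - g| / 2)%:C.
  have -> : `|p - g| / 2 = Num.sqrt (1 - (1 + (p * g + q * h)) / 2)
      * Num.sqrt (1 - (1 + (p * g - q * h)) / 2).
    have -> : `|p - g| / 2 = Num.sqrt (((p - g) / 2) ^+ 2).
      by rewrite sqrtr_sqr normrM [X in _ = _ * X]ger0_norm.
    rewrite -sqrtrM; last by rewrite subr_ge0; case/andP: x1.
    congr Num.sqrt; have q2 : q ^+ 2 = 1 - p ^+ 2 by rewrite -pq addrC addKr.
    have h2 : h ^+ 2 = 1 - g ^+ 2 by rewrite -gh addrC addKr.
    transitivity (((1 - p * g) ^+ 2 - q ^+ 2 * h ^+ 2) / 4); last by field.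
    by rewrite q2 h2; field.
  rewrite rmorphM/=; apply: (acts_byM rpi OQ (range_idem n)) => //.
    exact: b1E.
  exact: b2E.
have -> : (p - g + `|p - g|)%:C = 2^-1 * (Num.conj w0 * z + w0 * Num.conj z)
    + (- g%:C) * 1 + 2 * (`|p - g| / 2)%:C :> C.
  have -> : Num.conj w0 * z + w0 * Num.conj z = 2 * p%:C.
    rewrite mulrC -/v -addcJ; congr (_ + _).
    change (w0 * Num.conj z = Num.conj v).
    by rewrite /v rmorphM/= conjCK mulrC.
  rewrite !(rmorphD, rmorphM, rmorphN)/= -realC2V; by field.
apply: (acts_byD rpi) => //; first exact: sub_Z.
  apply: (acts_byD rpi); [exact: sub_Z|exact: sub_Z| |].
    apply: (acts_byZ rpi) => //.
    by apply: (acts_byD rpi); try exact: sub_Z; exact: (acts_byZ rpi).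
  by apply: (acts_byZ rpi) => //; exact: acts_by_id.
exact: (acts_byZ rpi).
Qed.

End Generators.

(** * The hull-kernel topology *)

Section PrimTopology.
Variables (R : realType) (A : cstarAlgType R) (O : subCstar A).

Lemma closed_contains a : O a -> closed [set P : Prim O | ideal_of P a].
Proof.
move=> Oa; apply/closed_Prim; apply/seteqP; split=> [P kP|P Pa b [_]].
  by apply: kP; split.
exact.
Qed.

(** A closed set is the hull of its kernel: the intersection, over [a] in that
    kernel, of the sets of ideals containing [a]. *)
Lemma continuous_Prim (X : topologicalType) (f : X -> Prim O) :
  (forall a, O a -> closed [set x | ideal_of (f x) a]) -> continuous f.
Proof.
move=> h; apply/continuous_closedP => D /closed_Prim cD.
have -> : f @^-1` D = \bigcap_(a in hk_kernel D) [set x | ideal_of (f x) a].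
  by rewrite -{1}cD.
by apply: closed_bigI => a [Oa _]; exact: h.
Qed.

End PrimTopology.

Definition restrict_char (R : realType) k (P : set (lattice k))
  (F : dual R [set: lattice k]) (z : set_type P) : R[i] := dual_appT F (val z).

Lemma restrict_charP (R : realType) k (P : set (lattice k)) (F : dual R [set: lattice k]) :
  is_character (@restrict_char R k P F).
Proof.
split=> [a|a b c abc]; first exact: charT_norm.
by rewrite /restrict_char abc charTD.
Qed.

Definition restriction (R : realType) k (P : set (lattice k))
  (F : dual R [set: lattice k]) : dual R P := mk_dual (restrict_charP P F).

Lemma extends_restriction (R : realType) k (P : set (lattice k))
  (F : dual R [set: lattice k]) : extends F (restriction P F).
Proof. by []. Qed.

Lemma restriction_extends (R : realType) k (P : set (lattice k))
  (F : dual R [set: lattice k]) (f : dual R P) : extends F f -> restriction P F = f.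
Proof. by move=> Ff; apply: dual_ext => z; rewrite -Ff. Qed.

Theorem theorem6p1 (R : realType) (k : nat) (k_gt0 : (0 < k)%N)
    (G : groupType) (G_countable : countable [set: G])
    (L : kGraph k) (S : selfSimilar G L)
    (FV : condFV S) (Cyc : condCyc S)
    (* O_{G,Lambda}, inside the unital C*-algebra A of the universal family *)
    (A : cstarAlgType R) (u : G -> A) (s : L -> A)
    (us_universal : universal_family S u s)
    (O : subCstar A) (O_def : sub_set O = OGL S u s)
    (one_tail : exists! T : set L, maximal_tail T)
    (Phi : tail_characters R S -> Prim O)
    (Phi_def : forall (T : tails L) (f : tail_dual R S T)
       (F : dual R [set: lattice k]) (x : raw_path L),
       extends F f -> cofinal_path (set_val T) x ->
       exists (H : hilbertType R) (delta : raw_path L -> H)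
              (pi : A -> {linear H -> H}),
         is_pi S u s O F x delta pi /\
         ideal_of (Phi (existT _ T f)) = rep_ker O pi)
    (Phi_bij : bijective Phi) :
  homeomorphism Phi.
Proof.
have us : family S u s by case: us_universal.
have Tvert (T : tails L) : set_val T = @vertices k L.
  by apply: unique_tail => //; exact: set_valP.
have T_eq (T T' : tails L) : T = T'.
  exact/val_inj/(etrans (Tvert T) (esym (Tvert T'))).
have extension (T : tails L) (f : tail_dual R S T) :
    exists F : dual R [set: lattice k], extends F f.
  by apply: char_extension => a b; exact: (Per_subgroup (Tvert T)).
have cofinal (T : tails L) x : infinite_path setT x -> cofinal_path (set_val T) x.
  by move=> ix; apply: path_cofinal => //; exact: set_valP.
split.
  suff PhiT T : continuous (fun f : tail_dual R S T => Phi (existT _ T f)).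
    by move=> [T f]; exact: (PhiT T f).
  apply: continuous_Prim => a Oa.
  (* The characters of [Z^k] whose representation kills [a] form a closed set,
     and the characters in question are the restrictions of its members. *)
  have [x ix] : exists x : omega k -> L, infinite_path setT x.
    have [v Tv] : set_val T !=set0 by case: (set_valP T).
    have dv : deg v = 0 by move: Tv; rewrite Tvert.
    by have [x ix _] := path_exists dv; exists x.
  pose K F := ideal_of (Phi (existT _ T (restriction _ F : tail_dual R S T))).
  have Kcl := kernel_closed FV O_def (K := K) ix Oa
    (fun F => Phi_def T _ F x (extends_restriction F) (cofinal T x ix)).
  have Kch : [set F : {ptws set_type [set: lattice k] -> R[i]^o} |
      exists2 F', set_val F' = F & K F' a] `<=` @is_character R k setT.
    by move=> _ [F <- _]; exact: dualP.
  have := closed_restriction (P := Per S (Hgraph S (set_val T))) Kch Kcl.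
  congr closed; apply/seteqP; split=> f /=.
    move=> [F Ff [F' /val_inj FF']]; rewrite /K FF'.
    by rewrite (restriction_extends Ff).
  have [F Ff] := extension T f => fa; exists F => //.
  by exists F => //; rewrite /K (restriction_extends Ff).
have [Psi PhiK PsiK] := Phi_bij.
exists Psi; split=> //.
have [T1m [T1mT _]] := one_tail.
pose T1 : tails L := exist _ T1m (mem_set T1mT).
have /choice[h hP] : forall P, exists f : tail_dual R S T1, Psi P = existT _ T1 f.
  by move=> P; case: (Psi P) => T f; have TT1 := T_eq T T1; subst T; exists f.
have PE P : P = Phi (existT _ T1 (h P)) by rewrite -hP PsiK.
suff hc : continuous h.
  have -> : Psi = existT _ T1 \o h by apply/funext => P; exact: hP.
  by move=> P; apply: continuous_comp; [exact: hc|exact: existT_continuous].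
apply: continuous_comp_initial; apply: continuous_ptws => z P0.
have [m [n [mn zE]]] := Per_cycline (Tvert T1) (set_valP z).
apply/(@cvgrPdist_lt R[i] R[i]^o (Prim O) (nbhs P0) (@nbhs_filter (Prim O) P0)).
move=> e0 /gt0_complex[r r0 ->].
set w0 := (set_val \o h) P0 z.
have w01 : `|w0| = 1 by exact: (dualP (h P0)).1.
(* With [v = w w0^-1] one has [|w0 - w| ^ 2 = 2 - 2 Re v], so the arc [Re v > g]
   lies in the ball of radius [t]; [t <= 1] keeps [g] in [-1, 1]. *)
pose t := Num.min r 1; pose g : R := 1 - t ^+ 2 / 2.
have t0 : 0 < t by rewrite lt_min r0 ltr01.
have t1 : t <= 1 by rewrite ge_min lexx orbT.
have tr : t <= r by rewrite ge_min lexx.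
have g1 : -1 <= g <= 1 by apply/andP; split; rewrite /g; nra.
have [a [Oa aP]] := arc_element FV us O_def mn w01 g1.
(* A path through [n] makes the projection onto [n] visible in every [pi_(F, y)]. *)
have [y iy ny] : exists2 y, infinite_path setT y & initial y (deg n) = n.
  have [x ix xn] := path_exists (deg_sc n).
  by have [y iy [ny _]] := concat_exists ix (esym xn); exists y.
have piP P : exists (H : hilbertType R) (delta : (omega k -> L) -> H)
    (pi : A -> {linear H -> H}),
    [/\ ideal_of P = rep_ker O pi, delta y <> 0,
     pi (s n ** star (s n)) (delta y) = delta y &
     acts_by pi (s n ** star (s n)) a
      (let p := complex.Re (set_val (h P) z * Num.conj w0)
       in p - g + `|p - g|)%:C].
  have [F Ff] := extension T1 (h P).
  have [H [delta [pi [piF idE]]]] := Phi_def T1 (h P) F y Ff (cofinal T1 y iy).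
  exists H, delta, pi; rewrite {1}[P]PE; split=> //.
  - exact: (basis_neq0 piF (orbit_refl S iy)).
  - exact: (range_basis FV us iy piF (orbit_refl S iy) ny).
  - by have := aP _ _ _ _ _ iy piF; rewrite -zE Ff.
have P0U : ~ ideal_of P0 a.
  have [H [delta [pi [-> dy0 Qy ay]]]] := piP P0.
  move=> [_ /(_ (delta y))]; rewrite ay Qy -/w0 -normCK w01 expr1n /=.
  move=> /eqP; rewrite scaler_eq0 => /orP[|/eqP//].
  rewrite -[0]/(0%:C) (inj_eq (@complexI R)) /g.
  by rewrite subKr ger0_norm ?divr_ge0 ?exprn_ge0 ?ltW// => /eqP; nra.
have : \forall P \near P0, ~ ideal_of P a.
  have := closed_contains Oa; rewrite -openC => oU.
  exact: (open_nbhs_nbhs (conj oU P0U)).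
apply: filterS => P; have [H [delta [pi [-> _ _ ay]]]] := piP P.
set w := set_val (h P) z in ay *; rewrite /= in ay.
set v := w * Num.conj w0 in ay.
move=> aker; have pg : g < complex.Re v.
  rewrite ltNge; apply/negP => pg; apply: aker; split=> // xi.
  by rewrite ay ler0_norm ?subr_le0// subrr scale0r.
have v1 : `|v| = 1 by rewrite normrM norm_conjC w01 mulr1; exact: (dualP (h P)).1.
have -> : `|w0 - w| = `|1 - v|.
  have w0w0 : w0 * Num.conj w0 = 1 by rewrite -normCK w01 expr1n.
  by rewrite /v -w0w0 -mulrBl normrM norm_conjC w01 mulr1.
clearbody v; case: v v1 pg {ay aker} => p q /= v1 pg.
have pq : p ^+ 2 + q ^+ 2 = 1.
  have := congr1 (fun c => complex.Re (c ^+ 2)) v1.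
  by rewrite -add_Re2_Im2 expr1n.
rewrite normc_def/= ltcR -(ger0_norm (ltW r0)) -sqrtr_sqr ltr_sqrt ?exprn_gt0//.
rewrite /g in pg; nra.
Qed.
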